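(* Assume that $N(s)$, $s\ge0$, is the mixed Poisson process with a structure cdf $L(\lambda)$, $\lambda\ge0$, and let $t>0$. Let each claim size $X_i$ depend on the claim arrival process only via the time $T_{i-1}$ of the previous claim and the inter-claim time $V_i=T_i-T_{i-1}$, and let the distribution of the product $X_iX_j$ depend on the claim times $T_{i-1}$ and $T_{j-1}$ as well as on the inter-claim times $V_i$ and $V_j$. Then $$ \mathbf{E}[S^2(t)]=\sum_{n=1}^\infty\pi^L_{t,n}\big(A^L_{t,n}+2B^L_{t,n}\big), $$ where $$ A^L_{t,n}=n\int_0^t\mathbf{E}\big[X_1^2\,|\,T_1=y\big]\frac{(t-y)^{n-1}}{t^n}\,dy $$ $$ \quad+\sum_{i=2}^n\frac{n!}{(i-2)!(n-i)!}\int_0^t\int_0^{t-x}\mathbf{E}\big[X_i^2\,|\,T_{i-1}=x,V_i=v\big]\frac{x^{i-2}(t-x-v)^{n-i}}{t^n}\,dv\,dx $$ and $$ B^L_{t,n}=n(n-1)\int_0^t\int_0^{t-y}\mathbf{E}\big[X_1X_2\,|\,T_1=y,V_2=v\big]\frac{(t-y-v)^{n-2}}{t^n}\,dv\,dy $$ $$ \quad+\sum_{j=3}^n\frac{n!}{(j-3)!(n-j)!}\int_0^t\int_y^t\int_0^{t-w}\mathbf{E}\big[X_1X_j\,|\,T_1=y,T_{j-1}=w,V_j=v\big]\frac{(w-y)^{j-3}(t-w-v)^{n-j}}{t^n}\,dv\,dw\,dy $$ $$ \quad+\sum_{i=2}^{n-1}\frac{n!}{(i-2)!(n-i-1)!}\int_0^t\int_0^{t-y}\int_0^{t-y-u}\mathbf{E}\big[X_iX_{i+1}\,|\,T_{i-1}=y,V_i=u,V_{i+1}=v\big]\frac{y^{i-2}(t-y-u-v)^{n-i-1}}{t^n}\,dv\,du\,dy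 $$ $$ \quad+\sum_{i=2}^{n-2}\sum_{j=i+2}^n\frac{n!}{(i-2)!(j-i-2)!(n-j)!}\int_0^t\int_0^{t-x}\int_{x+u}^t\int_0^{t-w}\mathbf{E}\big[X_iX_j\,|\,T_{i-1}=x,V_i=u,T_{j-1}=w,V_j=v\big] $$ $$ \qquad\qquad\times\frac{x^{i-2}(w-x-u)^{j-i-2}(t-w-v)^{n-j}}{t^n}\,dv\,dw\,du\,dx. $$
   Context: Setting. $0<T_1<T_2<\cdots$ are the claim arrival times, with $T_0=0$ (and $T_i=\infty$ if there are fewer than $i$ claims); $V_i=T_i-T_{i-1}$ are the inter-claim times; $X_1,X_2,\dots$ are the corresponding claim sizes (random variables). $N(s)$ is the number of claims arriving up to and including time $s$, i.e. the largest integer $m$ with $T_m\le s$; $N(0)=0$. The aggregate claim size is $S(t)=\sum_{i=1}^{N(t)}X_i$, with $S(t)=0$ when $N(t)=0$. Mixed Poisson process with structure cdf $L$: there is a nonnegative random variable $\Lambda$ with cdf $L$ such that, conditionally on $\Lambda=\lambda$, $N$ is a homogeneous Poisson process with rate $\lambda$. Thus $$\pi^L_{t,n}=\mathbf{P}[N(t)=n]=\int_0^\infty\frac{(\lambda t)^n}{n!}e^{-\lambda t}\,dL(\lambda).$$ The dependence assumptions mean: on $\{T_i<\infty\}$ (resp. $\{T_j<\infty\}$, $i<j$), the conditional distribution of $X_i$ (resp. $X_iX_j$) given the whole process $(N(s))_{s\ge0}$ is a function of the named times only. Conditional expectations given $T$'s and $V$'s denote the corresponding regression functions. Empty sums are $0$,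 $0^0=1$, and the term with factor $n(n-1)$ is read as $0$ for $n=1$. *)

(* Defs.v *)
From HB Require Import structures.
From mathcomp Require Import all_boot all_order all_algebra.
From mathcomp Require Import all_classical all_reals all_analysis.
From mathcomp Require Import measurable_realfun.

Set Implicit Arguments.
Unset Strict Implicit.
Unset Printing Implicit Defensive.

Import Order.TTheory GRing.Theory Num.Theory.
Import numFieldNormedType.Exports.

Local Open Scope classical_set_scope.
Local Open Scope ring_scope.

(* Unlike the library's poisson_pmf, which is 1 at rate 0, this is the Dirac
   mass at 0 when mu = 0, since 0 ^+ 0 = 1. *)
Definition poisson_weight (R : realType) (mu : R) (n : nat) : R :=
  mu ^+ n / n`!%:R * expR (- mu).

Definition mixed_poisson_weight (R : realType)
    (L : cumulativeBounded (0 : R) (1 : R)) (t : R) (n : nat) : \bar R :=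
  (\int[lebesgue_stieltjes_measure L]_(l in `[0%R, +oo[)
     (poisson_weight (l * t) n)%:E)%E.

Section ClaimProcess.
Context (d : measure_display) (Omega : measurableType d) (R : realType).
Variable P : probability Omega R.
Local Open Scope ereal_scope.

(* Claims are numbered from 1; T i is +oo when there are fewer than i claims.
   The last field says that N s is the largest m with T m <= s (in particular
   arrivals do not accumulate). *)
Record claim_arrivals (T : nat -> Omega -> \bar R) (N : R -> Omega -> nat) :
    Prop := ClaimArrivals {
  measurable_arrival : forall i, measurable_fun [set: Omega] (T i);
  arrival0 : forall w, T 0%N w = 0;
  arrival_lt : forall i w, T i w < +oo -> T i w < T i.+1 w;
  arrival_infty : forall i w, T i w = +oo -> T i.+1 w = +oo;
  arrival_count : forall s w, (0 <= s)%R ->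
    T (N s w) w <= s%:E /\ (forall m, T m w <= s%:E -> (m <= N s w)%N) }.

(* The inter-claim time; it is only used on the event T i < +oo. *)
Definition interclaim (T : nat -> Omega -> \bar R) (i : nat) (w : Omega) :
  \bar R := T i w - T i.-1 w.

(* Given Lambda, the process N has independent increments, the one over
   ]s l, s l.+1] being Poisson with mean Lambda * (s l.+1 - s l). *)
Definition mixed_poisson (Lambda : {RV P >-> R}) (N : R -> Omega -> nat) :
    Prop :=
  forall (k : nat) (s : nat -> R) (m : nat -> nat) (B : set R),
    (0 <= s 0%N)%R -> (forall l, (l < k)%N -> (s l <= s l.+1)%R) ->
    measurable B ->
    P (Lambda @^-1` B `&`
       [set w | forall l, (l < k)%N -> N (s l.+1) w = (N (s l) w + m l)%N])
    = \int[P]_(w in Lambda @^-1` B)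
        (\prod_(l < k)
           poisson_weight (Lambda w * (s l.+1 - s l)) (m l))%:E.

Definition sigma_process (N : R -> Omega -> nat) : set (set Omega) :=
  <<s [set F | exists s n, (0 <= s)%R /\ F = [set w | N s w = n]] >>.

(* On D, the conditional distribution of Y given the whole process N is a
   function of Z only. *)
Definition depends_only_via (N : R -> Omega -> nat)
    (dU : measure_display) (U : measurableType dU)
    (Y : Omega -> R) (D : set Omega) (Z : Omega -> U) : Prop :=
  exists k : R.-pker U ~> measurableTypeR R,
    forall (F : set Omega) (A : set (measurableTypeR R)),
      sigma_process N F -> measurable A ->
      P (F `&` D `&` Y @^-1` A) = \int[P]_(w in F `&` D) k (Z w) A.

Definition nonneg_regression (dU : measure_display) (U : measurableType dU)
    (Y : Omega -> \bar R) (D : set Omega) (Z : Omega -> U)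
    (g : U -> \bar R) : Prop :=
  [/\ measurable_fun [set: U] g, (forall u, 0 <= g u) &
      forall B, measurable B ->
        \int[P]_(w in D `&` Z @^-1` B) Y w
        = \int[P]_(w in D `&` Z @^-1` B) g (Z w)].

(* g is a version of u |-> E[Y | Z = u], with Z considered on the event D only.
   For signed Y this is the generalised conditional expectation
   E[Y^+ | Z] - E[Y^- | Z], so that integrability of Y is not presupposed;
   when Y is integrable on D it is the usual notion. *)
Definition regression (dU : measure_display) (U : measurableType dU)
    (Y : Omega -> R) (D : set Omega) (Z : Omega -> U)
    (g : U -> \bar R) : Prop :=
  measurable_fun [set: U] g /\
  exists gp gn : U -> \bar R,
    [/\ nonneg_regression (fun w => (EFin \o Y)^\+ w) D Z gp,
        nonneg_regression (fun w => (EFin \o Y)^\- w) D Z gn &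
        {ae P, forall w, D w -> g (Z w) = gp (Z w) - gn (Z w)}].

Definition aggregate_claims (N : R -> Omega -> nat) (X : nat -> {RV P >-> R})
    (t : R) (w : Omega) : R :=
  (\sum_(1 <= i < (N t w).+1) X i w)%R.

End ClaimProcess.

Section Coefficients.
Context (R : realType).
Local Open Scope ereal_scope.
Local Notation mu := (@lebesgue_measure R).

(* r1 y = E[X_1^2 | T_1 = y],
   r i (x, v) = E[X_i^2 | T_{i-1} = x, V_i = v]. *)
Definition square_coef (r1 : R -> \bar R) (r : nat -> R * R -> \bar R)
    (t : R) (n : nat) : \bar R :=
  n%:R%:E * \int[mu]_(y in `[0%R, t])
    (r1 y * ((t - y) ^+ n.-1 / t ^+ n)%:E)
  + \sum_(2 <= i < n.+1) (n`!%:R / ((i - 2)`! * (n - i)`!)%N%:R)%:E *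
      \int[mu]_(x in `[0%R, t]) \int[mu]_(v in `[0%R, (t - x)%R])
        (r i (x, v) * (x ^+ (i - 2) * (t - x - v) ^+ (n - i) / t ^+ n)%:E).

(* q12 (y, v) = E[X_1 X_2 | T_1 = y, V_2 = v],
   q1 j (y, w, v) = E[X_1 X_j | T_1 = y, T_{j-1} = w, V_j = v],
   qs i (y, u, v) = E[X_i X_{i+1} | T_{i-1} = y, V_i = u, V_{i+1} = v],
   q i j (x, u, w, v)
     = E[X_i X_j | T_{i-1} = x, V_i = u, T_{j-1} = w, V_j = v].
   In the first term n - 2 is truncated, but n (n - 1) = 0 for n = 1. *)
Definition cross_coef (q12 : R * R -> \bar R) (q1 : nat -> R * R * R -> \bar R)
    (qs : nat -> R * R * R -> \bar R)
    (q : nat -> nat -> R * R * R * R -> \bar R)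
    (t : R) (n : nat) : \bar R :=
  (n * n.-1)%N%:R%:E *
    \int[mu]_(y in `[0%R, t]) \int[mu]_(v in `[0%R, (t - y)%R])
      (q12 (y, v) * ((t - y - v) ^+ (n - 2) / t ^+ n)%:E)
  + \sum_(3 <= j < n.+1) (n`!%:R / ((j - 3)`! * (n - j)`!)%N%:R)%:E *
      \int[mu]_(y in `[0%R, t]) \int[mu]_(w in `[y, t])
      \int[mu]_(v in `[0%R, (t - w)%R])
        (q1 j (y, w, v) *
         ((w - y) ^+ (j - 3) * (t - w - v) ^+ (n - j) / t ^+ n)%:E)
  + \sum_(2 <= i < n) (n`!%:R / ((i - 2)`! * (n - i - 1)`!)%N%:R)%:E *
      \int[mu]_(y in `[0%R, t]) \int[mu]_(u in `[0%R, (t - y)%R])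
      \int[mu]_(v in `[0%R, (t - y - u)%R])
        (qs i (y, u, v) *
         (y ^+ (i - 2) * (t - y - u - v) ^+ (n - i - 1) / t ^+ n)%:E)
  + \sum_(2 <= i < n.-1) \sum_(i.+2 <= j < n.+1)
      (n`!%:R / ((i - 2)`! * (j - i - 2)`! * (n - j)`!)%N%:R)%:E *
      \int[mu]_(x in `[0%R, t]) \int[mu]_(u in `[0%R, (t - x)%R])
      \int[mu]_(w in `[(x + u)%R, t]) \int[mu]_(v in `[0%R, (t - w)%R])
        (q i j (x, u, w, v) *
         (x ^+ (i - 2) * (w - x - u) ^+ (j - i - 2) * (t - w - v) ^+ (n - j)
          / t ^+ n)%:E).

End Coefficients.

(* Main.v *)
From HB Require Import structures.
From mathcomp Require Import all_boot all_order all_algebra.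
From mathcomp Require Import all_classical all_reals all_analysis.
From mathcomp Require Import measurable_realfun.
From mathcomp Require Import ring lra zify.
Require Import Defs.

Set Implicit Arguments.
Unset Strict Implicit.
Unset Printing Implicit Defensive.

Import Order.TTheory GRing.Theory Num.Theory.
Import numFieldNormedType.Exports.

Local Open Scope classical_set_scope.
Local Open Scope ring_scope.
Local Open Scope ereal_scope.

(** Given that N t = n, the arrival times T 1 < ... < T n are distributed like
    an ordered uniform sample of [0, t]: their joint law is n! / t^n times
    Lebesgue measure on the simplex 0 < x_1 < ... < x_n <= t. For a mixed
    Poisson process this holds whatever the structure distribution is, because
    the probability that the n claims fall one by one into successive intervals
    ]a_i, b_i] is, given Lambda, the probability that N t = n times a factor
    free of Lambda ([box_weightE]). Successive intervals are enough to identify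
    a measure on the simplex ([simplex_measure_unique]), whence [arrivals_law].

    The coefficients are marginals of that uniform law. Integrating out m
    coordinates that lie between two retained ones, y < w, leaves the factor
    (w - y)^m / m! (Cauchy's formula for repeated integration,
    [simplex_integral_skip]), and passing from T i to the inter-claim time
    V i = T i - T (i - 1) is a translation. Keeping the times on which a claim,
    or a pair of claims, depends gives the five families of iterated integrals
    ([marginal_first] to [marginal_two_pairs]).

    The dependence assumption turns these marginals into expectations of
    claims. A regression function only prescribes integrals over events of the
    times it is a function of, and N t = n is not one of them; but the
    conditional law of the claim given the whole process is a function of the
    same times, so the regression function has the right integral over every
    event of the process ([ge0_regression_integral]). A product X_i X_j has no
    sign: its expectation is the difference of two nonnegative ones, of which
    the second is finite, and the iterated integrals of the coefficients respect
    such differences ([represents_splitting]). Hence every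
    term of the coefficients, multiplied by the probability of n claims, is the
    integral of X_i^2 or X_i X_j over the event N t = n ([regression_term]).

    Summing: on N t = n the square of the sum is expanded, the pairs i < j are
    sorted according to whether i = 1 and whether j = i + 1
    ([count_second_moment]), and the events N t = n partition the space. *)

(** * Measures on tuples *)

Section ProductMeasure.
Context (R : realType) d1 d2 (T1 : measurableType d1) (T2 : measurableType d2).
Variables (m1 : {sigma_finite_measure set T1 -> \bar R})
  (m2 : {sigma_finite_measure set T2 -> \bar R}).

(** The product measure under a name of its own, to which sigma-finiteness can
    be attached; the recursion on the dimension needs it at every step. *)
Definition prod_measure : set (T1 * T2) -> \bar R := m1 \x m2.

HB.instance Definition _ := Measure.on prod_measure.

Let prod_measure_sigma_finite : sigma_finite setT prod_measure.
Proof.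
have /sigma_finiteP[F [TF ndF Foo]] := sigma_finiteT m1.
have /sigma_finiteP[G [TG ndG Goo]] := sigma_finiteT m2.
exists (fun n => F n `*` G n).
  rewrite -setXTT TF TG predeqE => -[x y]; split.
    move=> [/= [n _ Fnx] [k _ Gky]]; exists (maxn n k) => //; split.
    - by move: x Fnx; exact/subsetPset/ndF/leq_maxl.
    - by move: y Gky; exact/subsetPset/ndG/leq_maxr.
  by move=> [n _ []/= ? ?]; split; exists n.
move=> k; have [? ?] := Foo k; have [? ?] := Goo k.
split; first exact: measurableX.
by rewrite /prod_measure product_measure1E// lte_mul_pinfty// ge0_fin_numE.
Qed.

HB.instance Definition _ := Measure_isSigmaFinite.Build _ _ _ prod_measure
  prod_measure_sigma_finite.

End ProductMeasure.

Section TupleMeasure.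
Context (R : realType) (d : measure_display) (X : measurableType d).
Variable l : {sigma_finite_measure set X -> \bar R}.

Definition cons_tup (n : nat) (p : X * n.-tuple X) : n.+1.-tuple X :=
  [the n.+1.-tuple X of p.1 :: p.2].

Lemma measurable_cons_tup n : measurable_fun setT (@cons_tup n).
Proof. by apply: measurable_cons; [exact: measurable_fst|exact: measurable_snd]. Qed.

Definition uncons_tup (n : nat) (v : n.+1.-tuple X) : X * n.-tuple X :=
  (tnth v ord0, [tuple of behead v]).

Lemma measurable_uncons_tup n : measurable_fun setT (@uncons_tup n).
Proof.
apply/measurable_fun_pair; first exact: measurable_tnth.
exact: measurable_behead.
Qed.

Lemma cons_tupK n : cancel (@cons_tup n) (@uncons_tup n).
Proof. by move=> [x v]; congr pair; apply: val_inj. Qed.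

Section step.
Variables (n : nat) (m : {sigma_finite_measure set (n.-tuple X) -> \bar R}).

Definition cons_measure : set (n.+1.-tuple X) -> \bar R :=
  pushforward (prod_measure l m) (@cons_tup n).

Let cons_measure0 : cons_measure set0 = 0.
Proof. by rewrite /cons_measure/= /pushforward preimage_set0 measure0. Qed.

Let cons_measure_ge0 A : 0 <= cons_measure A.
Proof. by rewrite /cons_measure /pushforward; exact: measure_ge0. Qed.

Let cons_measure_sigma_additive : semi_sigma_additive cons_measure.
Proof.
exact: (@measure_semi_sigma_additive _ _ _
  (measure_function_pushforward__canonical__measure_function_Measure
     (prod_measure l m)
     (@measurable_cons_tup n))).
Qed.

HB.instance Definition _ := isMeasure.Build _ _ _ cons_measure
  cons_measure0 cons_measure_ge0 cons_measure_sigma_additive.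

Let cons_measure_sigma_finite : sigma_finite setT cons_measure.
Proof.
have /sigma_finiteP[F [TF ndF Foo]] :=
  sigma_finiteT (prod_measure l m).
exists (fun k => @uncons_tup n @^-1` F k).
  by rewrite -preimage_bigcup -TF.
move=> k; have [mF Fk] := Foo k; split.
  by rewrite -[X in measurable X]setTI; exact: measurable_uncons_tup.
rewrite /cons_measure /pushforward; rewrite (_ : _ @^-1` _ = F k)//.
by apply/seteqP; split => x /=; rewrite cons_tupK.
Qed.

HB.instance Definition _ := @Measure_isSigmaFinite.Build _ _ _ cons_measure
  cons_measure_sigma_finite.

End step.

(** Recursion on the head of the tuple, so that integrals over tuples unfold
    into iterated integrals, first coordinate outermost. *)
Fixpoint tuple_measure n : {sigma_finite_measure set (n.-tuple X) -> \bar R} :=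
  match n with
  | 0%N => [the {sigma_finite_measure set _ -> \bar R} of \d_ [tuple]]
  | m.+1 => [the {sigma_finite_measure set _ -> \bar R} of
      cons_measure (tuple_measure m)]
  end.

Lemma tuple_measure0 (f : 0.-tuple X -> \bar R) :
  measurable_fun setT f -> \int[tuple_measure 0]_v f v = f [tuple].
Proof. by move=> mf; rewrite integral_dirac// diracT mul1e. Qed.

Lemma tuple_measureS n (f : n.+1.-tuple X -> \bar R) :
  measurable_fun setT f -> (forall v, 0 <= f v) ->
  \int[tuple_measure n.+1]_v f v =
  \int[l]_x \int[tuple_measure n]_v f (cons_tup (x, v)).
Proof.
move=> mf f0.
rewrite [LHS]ge0_integral_pushforward//; last exact: measurable_cons_tup.
rewrite preimage_setT [LHS]fubini_tonelli1//.
  exact: (measurableT_comp mf (@measurable_cons_tup n)).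
by move=> x; exact: f0.
Qed.

Lemma tuple_measure_box n (B : nat -> set X) :
  (forall i, measurable (B i)) ->
  tuple_measure n [set v | forall i : 'I_n, B i (tnth v i)] =
  \prod_(i < n) l (B i).
Proof.
elim: n B => [|n IHn] B mB.
  rewrite big_ord0 [LHS]/= diracE mem_set// => -[] //.
rewrite big_ord_recl -(IHn (fun i => B i.+1))//.
rewrite -[in RHS]product_measure1E//; last first.
  rewrite [X in measurable X](_ : _ =
    \bigcap_(i in [set: 'I_n]) ((@tnth n X)^~ i @^-1` B i.+1)); last first.
    by apply/seteqP; split => v /= vB i; [move=> _|]; exact: vB.
  apply: fin_bigcap_measurable => [|i _]; first exact: finite_finset.
  by rewrite -[X in measurable X]setTI; exact: measurable_tnth.
congr (product_measure1 _ _ _); apply/seteqP; split => -[x v] /=.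
  move=> H; split; first exact: (H ord0).
  by move=> i; have := H (lift ord0 i); rewrite tnthS.
move=> [Bx Bv] i; case: (unliftP ord0 i) => [j ->|->//].
by rewrite tnthS; exact: Bv.
Qed.

End TupleMeasure.

(** * Boxes and the simplex *)

Section OrderedBoxes.
Context (R : realType).
Local Notation RM := (measurableTypeR R).

Definition box n (a b : nat -> R) : set (n.-tuple RM) :=
  [set v | forall i : 'I_n, `]a i, b i]%classic (tnth v i)].
Arguments box : clear implicits.

Lemma measurable_box n a b : measurable (box n a b).
Proof.
rewrite /box [X in measurable X](_ : _ =
    \bigcap_(i in [set: 'I_n]) ((@tnth n RM)^~ i @^-1` `]a i, b i])); last first.
  by apply/seteqP; split => v /= vB i; [move=> _|]; exact: vB.
apply: fin_bigcap_measurable => [|i _]; first exact: finite_finset.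
rewrite -[X in measurable X]setTI; apply: measurable_tnth => //.
Qed.

Lemma box_setI n a b a' b' : box n a b `&` box n a' b' =
  box n (fun i => Num.max (a i) (a' i)) (fun i => Num.min (b i) (b' i)).
Proof.
apply/seteqP; split => v /=.
  move=> [H1 H2] i; have := H1 i; have := H2 i => /=.
  rewrite !in_itv/= gt_max le_min => /andP[h1 h2] /andP[h3 h4].
  by apply/andP; split; apply/andP.
by move=> H; split => i; have := H i => /=;
  rewrite !in_itv/= gt_max le_min => /andP[/andP[h1 h2] /andP[h3 h4]];
  apply/andP.
Qed.

Definition boxes n := [set B | exists a b, B = box n a b].
Arguments boxes : clear implicits.

Lemma measurable_tuple_boxes n :
  @measurable _ (n.-tuple RM) = <<s boxes n >>.
Proof.
apply/seteqP; split; last first.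
  apply: smallest_sub; first exact: sigma_algebra_measurable.
  by move=> _ [a [b ->]]; exact: measurable_box.
apply: smallest_sub; first exact: smallest_sigma_algebra.
rewrite -bigcup_seq => B [/= i _ [A mA <-]].
suff : measurable_fun [set: g_sigma_algebraType (boxes n)]
    ((@tnth n RM)^~ i : g_sigma_algebraType (boxes n) -> RM).
  by move=> /(_ measurableT A mA).
apply: (measurability _ (erefl (@measurable _ RM))) => _ [_ [[a b] _ <-] <-].
rewrite setTI [X in measurable X](_ : _ = \bigcup_(k : nat)
  box n (fun j => if j == i then a else - k%:R)%R
        (fun j => if j == i then b else k%:R)%R); last first.
  apply/seteqP; split => v /=.
    rewrite in_itv/= => vi.
    exists (Num.bound (\sum_(j < n) `|tnth v j|)%R) => //= j /=.
    rewrite in_itv/= val_eqE; case: eqP => [->//|_].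
    have : (`|tnth v j| < (Num.bound (\sum_(j < n) `|tnth v j|))%:R)%R.
      apply: (@le_lt_trans _ _ (\sum_(j < n) `|tnth v j|)%R).
        by rewrite (bigD1 j)//= lerDl sumr_ge0.
      by apply: archi_boundP; apply: sumr_ge0.
    by rewrite ltr_norml => /andP[-> /ltW].
  by move=> [k _ /(_ i)] /=; rewrite eqxx.
apply: bigcup_measurable => k _; apply: sub_sigma_algebra.
by eexists; eexists.
Qed.

(** Boxes form a generating class stable under intersection, and the cubes
    ]-k, k]^n exhaust the space. *)
Lemma box_measure_unique n (m1 m2 : {measure set (n.-tuple RM) -> \bar R}) :
  (forall a b, m1 (box n a b) = m2 (box n a b)) ->
  (forall a b, m1 (box n a b) < +oo) ->
  forall A, measurable A -> m1 A = m2 A.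
Proof.
move=> m12 m1oo.
apply: (measure_unique (boxes n) (fun k => box n (fun=> - k%:R)%R (fun=> k%:R)%R)).
- exact: measurable_tuple_boxes.
- move=> _ _ [a [b ->]] [a' [b' ->]]; rewrite box_setI.
  by exists (fun i => Num.max (a i) (a' i)), (fun i => Num.min (b i) (b' i)).
- by move=> i; exists (fun=> - i%:R)%R, (fun=> i%:R)%R.
- apply/seteqP; split => // v _.
  exists (Num.bound (\sum_(j < n) `|tnth v j|)%R) => //= j /=.
  have : (`|tnth v j| < (Num.bound (\sum_(j < n) `|tnth v j|))%:R)%R.
    apply: (@le_lt_trans _ _ (\sum_(j < n) `|tnth v j|)%R).
      by rewrite (bigD1 j)//= lerDl sumr_ge0.
    by apply: archi_boundP; apply: sumr_ge0.
  by rewrite in_itv/= ltr_norml => /andP[-> /ltW].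
- by move=> _ [a [b ->]].
- by move=> k.
Qed.

Lemma measurable_ltr_set d (T : measurableType d) (f g : T -> RM) :
  measurable_fun setT f -> measurable_fun setT g ->
  measurable [set x | (f x < g x)%R].
Proof.
move=> mf mg; rewrite -[X in measurable X]setTI.
exact: (measurable_fun_ltr mf mg measurableT (Y := [set true])).
Qed.

Lemma measurable_ler_set d (T : measurableType d) (f g : T -> RM) :
  measurable_fun setT f -> measurable_fun setT g ->
  measurable [set x | (f x <= g x)%R].
Proof.
move=> mf mg; rewrite -[X in measurable X]setTI.
exact: (measurable_fun_ler mf mg measurableT (Y := [set true])).
Qed.

Definition stepping (t : R) : rel R := fun x y => (x < y <= t)%R.

(** The chain a < x_1 < ... < x_n <= t. The lower end a is a parameter because
    fixing the first coordinate x leaves the simplex above x. *)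
Definition simplex n t (a : R) : set (n.-tuple RM) :=
  [set v | path (stepping t) a v].
Arguments simplex : clear implicits.

Lemma measurable_simplex2 n t :
  measurable [set p : RM * n.-tuple RM | simplex n t p.1 p.2].
Proof.
elim: n => [|n IHn].
  rewrite [X in measurable X](_ : _ = setT)//.
  by apply/seteqP; split => //= -[a v] _ /=; rewrite tuple0.
pose h (p : RM * n.+1.-tuple RM) := uncons_tup p.2.
have mh : measurable_fun setT h.
  exact: (measurableT_comp (@measurable_uncons_tup _ _ n)).
rewrite [X in measurable X](_ : _ =
  [set p : RM * n.+1.-tuple RM | (p.1 < (h p).1)%R] `&`
  [set p : RM * n.+1.-tuple RM | ((h p).1 <= t)%R] `&`
  (h @^-1` [set p : RM * n.-tuple RM | simplex n t p.1 p.2])); last first.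
  apply/seteqP; split => -[a v]; case/tupleP: v => y v;
    rewrite /simplex /h /uncons_tup /= tnth0.
    by move=> /andP[/andP[]].
  by move=> [[ay yt] yv]; apply/andP; split => //; apply/andP.
have mh1 : measurable_fun setT (fst \o h) by exact: measurableT_comp.
apply: measurableI; last by rewrite -[X in measurable X]setTI; exact: mh.
apply: measurableI.
  exact: (measurable_ltr_set measurable_fst mh1).
exact: (measurable_ler_set mh1 (measurable_cst t)).
Qed.

Lemma measurable_simplex n t a : measurable (simplex n t a).
Proof.
have := measurable_xsection a (@measurable_simplex2 n t).
by congr measurable; apply/seteqP; split => v; rewrite /xsection/= inE.
Qed.

End OrderedBoxes.
Arguments box {R} n a b.
Arguments simplex {R} n t a.

(** * Measures that agree on the simplex *)

Section SimplexUnique.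
Context (R : realType).
Local Notation RM := (measurableTypeR R).
Implicit Types (t : R) (n : nat).

(** Boxes whose sides are successive intervals of [0, t]: those for which the
    event that the arrival times fall into the box is an event about finitely
    many increments of the counting process. *)
Definition ordered_box n t (a b : nat -> R) :=
  [/\ (forall i, (i < n)%N -> 0 <= a i)%R,
      (forall i, (i < n)%N -> a i <= b i)%R,
      (forall i, (i.+1 < n)%N -> b i <= a i.+1)%R &
      (forall i, (i < n)%N -> b i <= t)%R].

Lemma box_eq0 n (a b : nat -> R) (i : 'I_n) : (b i <= a i)%R -> box n a b = set0.
Proof.
move=> ba; rewrite -subset0 => v /(_ i) /=; rewrite in_itv/= => /andP[av vb].
by have := lt_le_trans av (le_trans vb ba); rewrite ltxx.
Qed.

(** Ordered boxes are stable under intersection with arbitrary boxes, up to the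
    empty set; this is what lets the uniqueness theorem for boxes be applied
    inside a single ordered box. *)
Lemma ordered_box_setI n t a b a' b' : ordered_box n t a b ->
  box n a' b' `&` box n a b = set0 \/
  exists a1 b1, ordered_box n t a1 b1 /\ box n a' b' `&` box n a b = box n a1 b1.
Proof.
move=> [a0 ab ba bt]; rewrite box_setI.
set a1 := fun i => _; set b1 := fun i => _.
have [[i ba1]|H] := pselect (exists i : 'I_n, (b1 i <= a1 i)%R).
  by left; exact: box_eq0 ba1.
right; exists a1, b1; split => //; split => i ni.
- by rewrite /a1 le_max a0// orbT.
- by apply/ltW; rewrite ltNge; apply/negP => h; apply: H; exists (Ordinal ni).
- rewrite /a1 /b1 le_max; apply/orP; right.
  by rewrite ge_min ba// orbT.
- by rewrite /b1 ge_min bt// orbT.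
Qed.

Lemma ordered_box_measure_unique n t
    (m1 m2 : {measure set (n.-tuple RM) -> \bar R}) :
  (forall a b, ordered_box n t a b -> m1 (box n a b) = m2 (box n a b)) ->
  (forall a b, ordered_box n t a b -> m1 (box n a b) < +oo) ->
  forall a b A, ordered_box n t a b -> measurable A ->
  m1 (A `&` box n a b) = m2 (A `&` box n a b).
Proof.
move=> m12 m1oo a b A oab mA; have mC := @measurable_box R n a b.
apply: (@box_measure_unique _ _ (mrestr m1 mC) (mrestr m2 mC)) => // a' b';
  rewrite /= /mrestr.
  have [->|[a1 [b1 [ ob1 ->]]]] := ordered_box_setI a' b' oab.
    by rewrite !measure0.
  exact: m12.
have [->|[a1 [b1 [ ob1 ->]]]] := ordered_box_setI a' b' oab.
  by rewrite measure0.
exact: m1oo.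
Qed.

Lemma cell_exists (h x : R) : (0 < h)%R -> (0 < x)%R ->
  exists j : nat, (j%:R * h < x <= j.+1%:R * h)%R.
Proof.
move=> h0 x0.
have ex : exists k : nat, (x <= k%:R * h)%R.
  exists (Num.bound (x / h)); rewrite -ler_pdivrMr//.
  by apply/ltW/archi_boundP; rewrite divr_ge0// ltW.
case: (ex_minnP ex) => -[|k] xk kmin.
  by move: xk; rewrite mul0r leNgt x0.
exists k; rewrite xk andbT ltNge; apply/negP => /kmin.
by rewrite ltnn.
Qed.

(** Finitely many strict inequalities leave a common margin e; a grid finer than
    e then separates the coordinates of the chain. *)
Lemma path_gap t a (s : seq R) : path (stepping t) a s ->
  exists2 e : R, (0 < e)%R & path (fun x y => x + e < y <= t)%R a s.
Proof.
elim: s a => [a _|y s IHs a /= /andP[/andP[ay yt] /IHs[e e0 pe]]].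
  by exists 1%R.
exists (Num.min e ((y - a) / 2))%R; first by rewrite lt_min e0/=; lra.
rewrite yt andbT; apply/andP; split.
  have : (Num.min e ((y - a) / 2) <= (y - a) / 2)%R by rewrite ge_min lexx orbT.
  lra.
apply: sub_path pe => u v /= /andP[uv ->]; rewrite andbT.
by apply: le_lt_trans uv; rewrite lerD2l ge_min lexx.
Qed.

(** k.1 + 1 is the number of intervals of the grid on [0, t], and k.2 lists the
    interval in which each coordinate lies. *)
Definition cell n t (k : nat * n.-tuple nat) : set (n.-tuple RM) :=
  box n (fun i => (nth 0%N k.2 i)%:R * (t / k.1.+1%:R))%R
        (fun i => (nth 0%N k.2 i).+1%:R * (t / k.1.+1%:R))%R.

Definition ordered_cell n (k : nat * n.-tuple nat) : bool :=
  sorted ltn k.2 && all (fun j => j <= k.1)%N k.2.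

Lemma ordered_cellP n t k : (0 < t)%R -> @ordered_cell n k ->
  ordered_box n t (fun i => (nth 0%N k.2 i)%:R * (t / k.1.+1%:R))%R
    (fun i => (nth 0%N k.2 i).+1%:R * (t / k.1.+1%:R))%R.
Proof.
move: k => [M g] t0 /andP[/= /(sortedP 0%N) sg /allP gM].
have h0 : (0 <= t / M.+1%:R)%R by rewrite divr_ge0// ltW.
split => i ni.
- by rewrite mulr_ge0.
- by rewrite ler_wpM2r// ler_nat.
- by rewrite ler_wpM2r// ler_nat; apply: sg; rewrite size_tuple.
- rewrite mulrCA ger_pMr// ler_pdivrMr// mul1r ler_nat ltnS.
  by apply: gM; apply: mem_nth; rewrite size_tuple.
Qed.

Lemma simplex_cover n t : (0 < t)%R ->
  simplex n t 0%R `<=` \bigcup_(k in [set k | @ordered_cell n k]) cell t k.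
Proof.
move=> t0 v /= /path_gap[e e0 pe].
have [M hM] : exists M : nat, (t / M.+1%:R < e)%R.
  exists (Num.bound (t / e)); rewrite ltr_pdivrMr// mulrC -ltr_pdivrMr//.
  apply: (@lt_le_trans _ _ (Num.bound (t / e))%:R).
    by apply: archi_boundP; rewrite divr_ge0// ltW.
  by rewrite ler_nat.
have h0 : (0 < t / M.+1%:R)%R by rewrite divr_gt0.
pose j (x : R) : nat := if pselect (0 < x)%R is left x0 then
  projT1 (cid (cell_exists h0 x0)) else 0%N.
have jP x : (0 < x)%R ->
    ((j x)%:R * (t / M.+1%:R) < x <= (j x).+1%:R * (t / M.+1%:R))%R.
  by rewrite /j; case: pselect => // x0 _; case: (cid _).
have pos : all (fun x => 0 < x <= t)%R v.
  have tr : transitive (stepping t).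
    move=> y x z /andP[xy _] /andP[yz zt].
    by rewrite /stepping (lt_trans xy yz).
  apply: (order_path_min tr); apply: sub_path pe => x y /andP[xy].
  by rewrite /stepping => ->; rewrite andbT (lt_trans _ xy)// ltrDl.
exists (M, [tuple of map j v]) => /=; last first.
  move=> i /=; rewrite in_itv/= (nth_map 0%R) ?size_tuple// -tnth_nth.
  by apply: jP; have /andP[] := allP pos _ (mem_tnth i v).
apply/andP; split => /=; last first.
  rewrite all_map; apply: sub_all pos => x /= /andP[x0 xt].
  have /andP[jx _] := jP _ x0.
  have := lt_le_trans jx xt; rewrite mulrCA gtr_pMr//.
  by rewrite ltr_pdivrMr// mul1r ltr_nat ltnS.
have: sorted (fun x y => x + t / M.+1%:R < y)%R v.
  apply: (path_sorted (x := 0%R)); apply: sub_path pe => x y /andP[xy _].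
  by apply: lt_trans xy; rewrite ltrD2l.
move=> srt; rewrite sorted_map; apply: sub_in_sorted pos srt => x y.
rewrite !unfold_in => /andP[x0 _] /andP[y0 _] xy.
have /andP[jx _] := jP _ x0; have /andP[_ jy] := jP _ y0.
rewrite /= -ltnS -(ltr_nat R) -(ltr_pM2r h0).
rewrite -[X in (X%:R * _)%R]addn1 natrD mulrDl mul1r (lt_le_trans _ jy)//.
by apply: lt_trans xy; rewrite ltrD2r.
Qed.

(** The cells with increasing indices, over all grids, are countably many
    ordered boxes that cover the simplex, and two measures as above coincide
    inside each of them. The cells overlap, so they are made disjoint first. *)
Theorem simplex_measure_unique n t
    (m1 m2 : {measure set (n.-tuple RM) -> \bar R}) : (0 < t)%R ->
  (forall a b, ordered_box n t a b -> m1 (box n a b) = m2 (box n a b)) ->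
  (forall a b, ordered_box n t a b -> m1 (box n a b) < +oo) ->
  forall A, measurable A ->
  m1 (A `&` simplex n t 0%R) = m2 (A `&` simplex n t 0%R).
Proof.
move=> t0 m12 m1oo A mA.
pose C i := if unpickle i is Some k then
  if @ordered_cell n k then cell t k else set0 else set0.
have mC i : measurable (C i).
  rewrite /C; case: unpickle => // k; case: ifP => // _.
  exact: measurable_box.
have mS : measurable (A `&` simplex n t 0%R).
  by apply: measurableI => //; exact: measurable_simplex.
have cov : A `&` simplex n t 0%R = \bigcup_i (A `&` simplex n t 0%R `&` seqDU C i).
  rewrite -setI_bigcupr -seqDU_bigcup_eq; apply/esym/setIidPl => v [_].
  move=> /(simplex_cover t0)[k ok vk]; exists (pickle k) => //.
  by rewrite /C pickleK ok.
have mD i : measurable (seqDU C i).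
  by apply: measurableD => //; exact: bigsetU_measurable.
have tr : trivIset setT (fun i => A `&` simplex n t 0%R `&` seqDU C i).
  exact/trivIset_setIl/trivIset_seqDU.
rewrite cov !measure_bigcup//; do ?by move=> i _; exact: measurableI.
apply: eq_eseriesr => i _.
have -> : A `&` simplex n t 0%R `&` seqDU C i =
    A `&` simplex n t 0%R `&` seqDU C i `&` C i.
  by apply/esym/setIidPl => v [_ []].
rewrite /C; case: unpickle => [k|]; last by rewrite setI0 !measure0.
case: ifP => ok; last by rewrite setI0 !measure0.
apply: (ordered_box_measure_unique m12 m1oo).
  exact: ordered_cellP.
exact: measurableI.
Qed.

End SimplexUnique.

(** * Iterated integrals over the simplex *)

Section PolyIntegral.
Context (R : realType).
Local Notation leb := (@lebesgue_measure R).

Lemma integral_deriv_poly (p : {poly R}) (a b : R) : (a <= b)%R ->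
  \int[leb]_(x in `[a, b]) (p^`().[x])%:E = (p.[b] - p.[a])%:E.
Proof.
rewrite le_eqVlt => /predU1P[<-|ab].
  by rewrite set_itv1 integral_set1 subrr.
rewrite (@continuous_FTC2 _ _ (horner p))//.
- by apply: continuous_subspaceT => x; exact: continuous_horner.
- split.
  + by move=> x _; exact: derivable_horner.
  + by apply: cvg_at_right_filter; exact: continuous_horner.
  + by apply: cvg_at_left_filter; exact: continuous_horner.
- by move=> x _; rewrite derivE.
Qed.

(** The volume of the simplex with m coordinates in an interval of length x. *)
Definition divpow (m : nat) (x : R) : R := (x ^+ m / m`!%:R)%R.

Lemma divpow0 x : divpow 0 x = 1%R.
Proof. by rewrite /divpow fact0 divr1. Qed.

Lemma integral_divpowBr m (a b : R) : (a <= b)%R ->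
  \int[leb]_(x in `[a, b]) (divpow m (x - a))%:E = (divpow m.+1 (b - a))%:E.
Proof.
move=> ab.
pose p : {poly R} := ((m.+1`!%:R^-1)%:P * ('X - a%:P) ^+ m.+1)%R.
have pE x : p.[x] = divpow m.+1 (x - a).
  by rewrite /p hornerCM horner_exp hornerXsubC /divpow mulrC.
have pD x : p^`().[x] = divpow m (x - a).
  rewrite /p derivM derivC mul0r add0r deriv_exp derivXsubC mul1r.
  rewrite hornerCM hornerMn horner_exp hornerXsubC /divpow factS natrM invfM.
  rewrite -(mulr_natr (_ ^+ _)%R) /= mulrC -!mulrA; congr *%R.
  by rewrite mulrA divff ?mul1r// pnatr_eq0.
under eq_integral do rewrite -pD.
by rewrite integral_deriv_poly// !pE subrr /divpow expr0n mul0r subr0.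
Qed.

Lemma integral_divpowBl m (a b : R) : (a <= b)%R ->
  \int[leb]_(x in `[a, b]) (divpow m (b - x))%:E = (divpow m.+1 (b - a))%:E.
Proof.
move=> ab.
pose p : {poly R} := ((- m.+1`!%:R^-1)%:P * (b%:P - 'X) ^+ m.+1)%R.
have pE x : p.[x] = (- divpow m.+1 (b - x))%R.
  by rewrite /p hornerCM horner_exp hornerD hornerN hornerX hornerC /divpow mulNr mulrC.
have pD x : p^`().[x] = divpow m (b - x).
  rewrite /p derivM derivC mul0r add0r deriv_exp derivB derivC derivX sub0r mulN1r.
  rewrite hornerCM hornerMn hornerN horner_exp hornerD hornerN hornerX hornerC.
  rewrite /divpow factS natrM invfM.
  rewrite mulNr mulNrn mulrN opprK -(mulr_natr (_ ^+ _)%R) /= mulrC -!mulrA; congr *%R.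
  by rewrite mulrA divff ?mul1r// pnatr_eq0.
under eq_integral do rewrite -pD.
by rewrite integral_deriv_poly// !pE subrr /divpow expr0n mul0r oppr0 sub0r opprK.
Qed.

Lemma divpow_ge0 m x : (0 <= x)%R -> (0 <= divpow m x)%R.
Proof. by move=> x0; rewrite divr_ge0 ?exprn_ge0. Qed.

Lemma measurable_divpow m : measurable_fun setT (divpow m).
Proof.
apply: measurable_funM => //.
Qed.

End PolyIntegral.

Lemma measurable_patch d1 d2 (T1 : measurableType d1) (T2 : measurableType d2)
    (D : set T1) (f : T1 -> T2) : measurable D ->
  measurable_fun setT f -> measurable_fun setT (f \_ D).
Proof.
by move=> mD mf; apply/(measurable_restrictT f mD); exact: measurable_funTS.
Qed.

Section SimplexIntegral.
Context (R : realType).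
Local Notation RM := (measurableTypeR R).
Local Notation leb := (@lebesgue_measure R).
Implicit Types (t a x : R) (f : seq R -> \bar R).

(** The integrand is a function of lists, so that its type does not depend on
    the number of coordinates already integrated out. *)
Definition simplex_integral n t a f : \bar R :=
  \int[tuple_measure leb n]_(v in simplex n t a) f v.

Definition seq_measurable f :=
  forall n, measurable_fun setT (fun v : n.-tuple RM => f v).

Lemma seq_measurable_cons f n : seq_measurable f ->
  measurable_fun [set: (RM * n.-tuple RM)%type] (fun p : RM * n.-tuple RM => f (p.1 :: p.2)).
Proof.
move=> mf; exact: (measurableT_comp (mf n.+1) (@measurable_cons_tup _ RM n)).
Qed.

Lemma seq_measurable_cons1 f x : seq_measurable f ->
  seq_measurable (fun s => f (x :: s)).
Proof.
move=> mf n; have mc := @seq_measurable_cons f n mf.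
exact: (measurableT_comp mc (measurable_pair1 x)).
Qed.

Lemma simplex_integral_ge0 n t a f : (forall s, 0 <= f s) ->
  0 <= simplex_integral n t a f.
Proof. by move=> f0; exact: integral_ge0. Qed.

Lemma measurable_simplex_patch n t f : seq_measurable f ->
  measurable_fun [set: (RM * n.-tuple RM)%type]
    ((fun p : RM * n.-tuple RM => f (p.1 :: p.2)) \_
       [set p : RM * n.-tuple RM | simplex n t p.1 p.2]).
Proof.
move=> mf.
exact: (measurable_patch (@measurable_simplex2 R n t) (@seq_measurable_cons f n mf)).
Qed.

Lemma simplex_integral_patchE n t x f :
  simplex_integral n t x (fun s => f (x :: s)) =
  \int[tuple_measure leb n]_v
    ((fun p : RM * n.-tuple RM => f (p.1 :: p.2)) \_
       [set p : RM * n.-tuple RM | simplex n t p.1 p.2]) (x, v).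
Proof.
rewrite /simplex_integral integral_mkcond; apply: eq_integral => v _.
by rewrite /patch /= !mem_setE.
Qed.

Lemma measurable_simplex_integral n t f : seq_measurable f ->
  (forall s, 0 <= f s) ->
  measurable_fun [set: RM]
    (fun x : RM => simplex_integral n t x (fun s => f (x :: s))).
Proof.
move=> mf f0; under eq_fun do rewrite simplex_integral_patchE.
apply: (measurable_fun_fubini_tonelli_F _ (@measurable_simplex_patch n t f mf)).
by move=> p; exact: erestrict_ge0.
Qed.

Lemma simplex_integral0 t a f : seq_measurable f ->
  simplex_integral 0 t a f = f [::].
Proof.
move=> mf; rewrite /simplex_integral (_ : simplex 0 t a = setT).
  by rewrite tuple_measure0.
by apply/seteqP; split => // v _; rewrite /simplex /= tuple0.
Qed.

Lemma mem_simplexS n t a x (v : n.-tuple RM) :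
  (cons_tup (x, v) \in simplex n.+1 t a) =
  (a < x <= t)%R && (v \in simplex n t x).
Proof.
apply/idP/idP => [/set_mem/= /andP[ax p]|/andP[ax /set_mem/= p]].
  by apply/andP; split => //; exact/mem_set.
by apply/mem_set/andP.
Qed.

Lemma simplex_integralS n t a f : seq_measurable f -> (forall s, 0 <= f s) ->
  simplex_integral n.+1 t a f =
  \int[leb]_(x in `[a, t]) simplex_integral n t x (fun s => f (x :: s)).
Proof.
move=> mf f0.
rewrite -integral_itv_obnd_cbnd; last first.
  by apply: measurable_funTS; exact: measurable_simplex_integral.
rewrite /simplex_integral integral_mkcond tuple_measureS; last 2 first.
- exact: (measurable_patch (@measurable_simplex R n.+1 t a) (mf n.+1)).
- by move=> v; exact: erestrict_ge0.
rewrite [RHS]integral_mkcond; apply: eq_integral => x _.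
rewrite [RHS]patchE; case: ifPn => [|]; rewrite ?inE ?notin_setE/= in_itv/=.
  move=> xat; rewrite [RHS]integral_mkcond; apply: eq_integral => v _.
  by rewrite /patch mem_simplexS xat.
move=> /negP/negbTE xat; apply: integral0_eq => v _.
by rewrite /patch mem_simplexS xat.
Qed.

End SimplexIntegral.

Lemma mem_setb (T : Type) (P : T -> bool) (x : T) :
  (x \in [set y | P y]) = P x.
Proof. by apply/idP/idP => [/set_mem|/mem_set]. Qed.

Section RepeatedIntegral.
Context (R : realType).
Local Notation RM := (measurableTypeR R).
Local Notation leb := (@lebesgue_measure R).
Implicit Types (t a x : R) (f : seq R -> \bar R).

Lemma measurable_triangle t a :
  measurable [set p : RM * RM | [&& a <= p.1, p.1 <= p.2 & p.2 <= t]%R].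
Proof.
rewrite [X in measurable X](_ : _ = [set p : RM * RM | (a <= p.1)%R] `&`
  [set p : RM * RM | (p.1 <= p.2)%R] `&` [set p : RM * RM | (p.2 <= t)%R]).
  apply: measurableI; first apply: measurableI.
  - exact: (measurable_ler_set (measurable_cst a) measurable_fst).
  - exact: (measurable_ler_set measurable_fst measurable_snd).
  - exact: (measurable_ler_set measurable_snd (measurable_cst t)).
apply/seteqP; split => p /=; first by move=> /and3P[].
by move=> [[-> ->] ->].
Qed.

Lemma integral_triangle t a (h : RM * RM -> \bar R) :
  measurable_fun [set: (RM * RM)%type] h -> (forall p, 0 <= h p) ->
  \int[leb]_(y in `[a, t]) \int[leb]_(x in `[y, t]) h (y, x) =
  \int[leb]_(x in `[a, t]) \int[leb]_(y in `[a, x]) h (y, x).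
Proof.
move=> mh h0.
pose T := [set p : RM * RM | [&& a <= p.1, p.1 <= p.2 & p.2 <= t]%R].
have mT : measurable T := measurable_triangle t a.
transitivity (\int[leb]_y \int[leb]_x (h \_ T) (y, x)).
  rewrite integral_mkcond; apply: eq_integral => y _.
  rewrite patchE; case: ifPn => [|]; rewrite ?inE ?notin_setE/= in_itv/=.
    move=> /andP[ay yt]; rewrite integral_mkcond; apply: eq_integral => x _.
    by rewrite !patchE !mem_setb /= in_itv/= ay.
  move=> yat; apply/esym/integral0_eq => x _; rewrite patchE mem_setb /=.
  by case: ifP => // /and3P[ay yx xt]; case: yat; rewrite ay (le_trans yx).
rewrite (fubini_tonelli (h \_ T)); last 2 first.
- exact: measurable_patch.
- by move=> p; exact: erestrict_ge0.
rewrite [RHS]integral_mkcond; apply: eq_integral => x _.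
rewrite [RHS]patchE; case: ifPn => [|]; rewrite ?inE ?notin_setE/= in_itv/=.
  move=> /andP[ax xt]; rewrite [RHS]integral_mkcond; apply: eq_integral => y _.
  by rewrite !patchE !mem_setb /= in_itv/= xt andbT.
move=> xat; apply: integral0_eq => y _; rewrite patchE mem_setb /=.
by case: ifP => // /and3P[ay yx xt]; case: xat; rewrite xt (le_trans ay).
Qed.

Lemma seq_measurable_drop m f : seq_measurable f ->
  seq_measurable (fun s => f (drop m s)).
Proof.
move=> mf n.
have mt : measurable_fun [set: n.-tuple RM]
    (fun v : n.-tuple RM => [tuple of drop m v] : (n - m).-tuple RM).
  apply/measurable_fun_tnthP => i.
  have imn : (m + i < n)%N by have := ltn_ord i; rewrite ltn_subRL.
  rewrite (_ : _ \o _ = (@tnth n RM)^~ (Ordinal imn)); first exact: measurable_tnth.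
  apply/funext => v /=.
  by rewrite !(tnth_nth (0%R : R)) /= nth_drop.
exact: (measurableT_comp (mf (n - m)%N) mt).
Qed.

(** Cauchy's formula for repeated integration: m coordinates between a and x on
    which the integrand does not depend contribute (x - a)^m / m!. *)
Lemma simplex_integral_skip m k t a f :
  seq_measurable f -> (forall s, 0 <= f s) ->
  simplex_integral (m.+1 + k) t a (fun s => f (drop m s)) =
  \int[leb]_(x in `[a, t])
    ((divpow m (x - a))%:E * simplex_integral k t x (fun s => f (x :: s))).
Proof.
move=> mf f0; elim: m a => [|m IHm] a.
  rewrite add1n simplex_integralS//; last first.
    by move=> n; under eq_fun do rewrite drop0; exact: mf.
  by apply: eq_integral => x _; rewrite divpow0 mul1e; under eq_fun do rewrite drop0.
rewrite addSn simplex_integralS//; last exact: seq_measurable_drop.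
under eq_integral do rewrite IHm.
pose H x := simplex_integral k t x (fun s => f (x :: s)).
have mH : measurable_fun [set: RM] (H : RM -> \bar R).
  exact: measurable_simplex_integral.
have H0 x : 0 <= H x by exact: simplex_integral_ge0.
(* The maximum with 0 makes h nonnegative off the triangle as well, as Tonelli
   requires. *)
pose h (p : RM * RM) := (Num.max 0 (divpow m (p.2 - p.1)%R))%:E * H p.2.
transitivity (\int[leb]_(y in `[a, t]) \int[leb]_(x in `[y, t]) h (y, x)).
  apply: eq_integral => y _; apply: eq_integral => x.
  rewrite inE /= in_itv/= => /andP[yx _].
  by rewrite /h /= max_r// divpow_ge0// subr_ge0.
rewrite integral_triangle; last 2 first.
- apply: emeasurable_funM; last first.
    exact: (measurableT_comp mH measurable_snd).
  apply/measurable_EFinP; apply: measurable_maxr => //.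
  apply: (measurableT_comp (@measurable_divpow R m)).
  exact: (measurable_funB measurable_snd measurable_fst).
- by move=> p; rewrite mule_ge0// lee_fin le_max lexx.
apply: eq_integral => x; rewrite inE/= in_itv/= => /andP[ax xt].
rewrite -integral_divpowBl// -ge0_integralZr//; last 3 first.
- apply/measurable_EFinP; apply: measurable_funTS.
  apply: (measurableT_comp (@measurable_divpow R m)).
  exact: measurable_funB.
- by move=> y /=; rewrite in_itv/= => /andP[_ yx]; rewrite lee_fin divpow_ge0// subr_ge0.
- exact: H0.
apply: eq_integral => y; rewrite inE/= in_itv/= => /andP[_ yx].
by rewrite /h /= max_r// divpow_ge0// subr_ge0.
Qed.

Lemma simplex_integral_cst k t a c : (a <= t)%R -> 0 <= c ->
  simplex_integral k t a (fun=> c) = (divpow k (t - a))%:E * c.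
Proof.
case: k => [|m] at' c0.
  by rewrite simplex_integral0 ?divpow0 ?mul1e// => n; exact: measurable_cst.
have mc : seq_measurable (fun=> c) by move=> n; exact: measurable_cst.
rewrite -[X in simplex_integral X](addn0 m.+1) (simplex_integral_skip m 0 t a mc)//.
rewrite -integral_divpowBr// -ge0_integralZr//; last 2 first.
- apply/measurable_EFinP; apply: measurable_funTS.
  apply: (measurableT_comp (@measurable_divpow R m)).
  exact: measurable_funB.
- by move=> y /=; rewrite in_itv/= => /andP[ay _]; rewrite lee_fin divpow_ge0// subr_ge0.
apply: eq_integral => x _.
by rewrite simplex_integral0// => n; exact: measurable_cst.
Qed.

End RepeatedIntegral.

(** * The arrival times given the number of claims *)

Section RestrictedLaw.
Context d (T : measurableType d) (R : realType).
Variable m : {measure set T -> \bar R}.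

Lemma ge0_integral_mrestr (E : set T) (mE : measurable E) (f : T -> \bar R) :
  measurable_fun setT f -> (forall x, 0 <= f x) ->
  \int[mrestr m mE]_x f x = \int[m]_(x in E) f x.
Proof.
move=> mf f0; rewrite -(setUv E) ge0_integral_setU//; last 3 first.
- exact: measurableC.
- by rewrite setUv.
- exact/disj_setPCl.
rewrite [X in _ + X](_ : _ = 0) ?adde0; last first.
  apply: null_set_integral; first exact: measurableC.
    exact: measurable_funTS.
  by rewrite /= /mrestr setICl measure0.
apply: eq_measure_integral => A mA AE; rewrite /= /mrestr.
by congr (m _); exact/setIidPl.
Qed.

End RestrictedLaw.

Section RestrictedLawTransfer.
Context d (T : measurableType d) (R : realType).
Variable m : {measure set T -> \bar R}.

(** Change of variables for a map Z that, restricted to E, is distributed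
    according to a multiple of a measure on S. *)
Lemma ge0_integral_restricted_law d' (U : measurableType d') (Z : T -> U)
    (E : set T) (l : {measure set U -> \bar R}) (S : set U) (c : {nonneg R})
    (f : U -> \bar R) :
  measurable E -> measurable S -> measurable_fun setT Z ->
  (forall A, measurable A -> m (E `&` Z @^-1` A) = c%:num%:E * l (A `&` S)) ->
  measurable_fun setT f -> (forall x, 0 <= f x) ->
  \int[m]_(x in E) f (Z x) = c%:num%:E * \int[l]_(x in S) f x.
Proof.
move=> mE mS mZ H mf f0.
rewrite -ge0_integral_mrestr//; last exact: measurableT_comp.
rewrite -(ge0_integral_mrestr l mS)// -ge0_integral_mscale//.
rewrite -[LHS](@ge0_integral_pushforward _ _ _ _ _ Z mZ (mrestr m mE) setT f)//.
apply: eq_measure_integral => A mA _.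
by change (m (Z @^-1` A `&` E) = c%:num%:E * l (A `&` S)); rewrite setIC H.
Qed.

End RestrictedLawTransfer.

Section Arrivals.
Context (d : measure_display) (Omega : measurableType d) (R : realType).
Variables (P : probability Omega R) (T : nat -> Omega -> \bar R)
  (N : R -> Omega -> nat).
Hypothesis HT : claim_arrivals T N.
Local Notation RM := (measurableTypeR R).

Lemma arrival_leS i w : T i w <= T i.+1 w.
Proof.
have [Ti|] := ltP (T i w) +oo; first exact/ltW/(arrival_lt HT).
by rewrite leye_eq => /eqP Ti; rewrite (arrival_infty HT Ti) leey.
Qed.

Lemma arrival_homo w : {homo T^~ w : i j / (i <= j)%N >-> i <= j}.
Proof. by apply: homo_leq => [i|i j k /le_trans|i]; [|exact|exact: arrival_leS]. Qed.

Lemma arrival_ge0 i w : 0 <= T i w.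
Proof. by have := arrival_homo w (leq0n i); rewrite (arrival0 HT). Qed.

Lemma arrival_countE m s w : (0 <= s)%R -> (T m w <= s%:E) = (m <= N s w)%N.
Proof.
move=> s0; have [TN Tm] := arrival_count HT w s0.
apply/idP/idP => [/Tm//|mN].
by apply: le_trans TN; exact: arrival_homo.
Qed.

Lemma arrival_fin_num i w : T i w < +oo -> T i w \is a fin_num.
Proof. by move=> Ti; rewrite ge0_fin_numE// arrival_ge0. Qed.

Lemma count0 w : N 0 w = 0%N.
Proof.
apply/eqP; rewrite -leqn0 leqNgt -arrival_countE// -ltNge.
by have := @arrival_lt _ _ _ _ _ HT 0%N w; rewrite (arrival0 HT); apply.
Qed.

Lemma measurable_arrival_le i (s : R) : measurable [set w | T i w <= s%:E].
Proof.
rewrite -[X in measurable X]setTI.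
exact: (emeasurable_fun_infty_c measurableT (measurable_arrival HT i)).
Qed.

Lemma count_eqE n (s : R) : (0 <= s)%R -> [set w | N s w = n] =
  [set w | T n w <= s%:E] `\` [set w | T n.+1 w <= s%:E].
Proof.
move=> s0; apply/seteqP; split => w /=; rewrite !arrival_countE//.
  by move=> ->; rewrite leqnn ltnn.
by move=> [nN /negP]; rewrite -leqNgt => Nn; apply/eqP; rewrite eqn_leq nN Nn.
Qed.

Lemma measurable_count n (s : R) : (0 <= s)%R -> measurable [set w | N s w = n].
Proof.
by move=> s0; rewrite count_eqE//; apply: measurableD; exact: measurable_arrival_le.
Qed.

Definition arrivals n (w : Omega) : n.-tuple RM :=
  [tuple fine (T i.+1 w) | i < n].

Lemma measurable_arrivals n : measurable_fun setT (arrivals n).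
Proof.
apply/measurable_fun_tnthP => i.
rewrite (_ : _ \o _ = fine \o T i.+1); last first.
  by apply/funext => w /=; rewrite tnth_mktuple.
apply: (measurableT_comp _ (measurable_arrival HT i.+1)).
exact: fine_measurable.
Qed.

Lemma nth_arrivals n w i : (i <= n)%N ->
  nth 0%R (0%R :: arrivals n w) i = fine (T i w).
Proof.
case: i => [|i] ni /=; first by rewrite (arrival0 HT).
rewrite -[RHS](tnth_mktuple (fun i : 'I_n => fine (T i.+1 w)) (Ordinal ni)).
by rewrite (tnth_nth (0%R : R)).
Qed.

(** On N t = n the first n arrival times are at most t, so none of the entries
    of arrivals is the value 0 that fine gives to an infinite time. *)
Lemma arrivals_simplex n t w : (0 <= t)%R -> N t w = n ->
  simplex n t 0%R (arrivals n w).
Proof.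
move=> t0 Nn; apply/(pathP 0%R) => i; rewrite size_tuple => ni.
have -> : nth 0%R (arrivals n w) i = fine (T i.+1 w) by rewrite -(nth_arrivals w ni).
have -> : nth 0%R (0%R :: arrivals n w) i = fine (T i w) by rewrite nth_arrivals// ltnW.
have Tt j : (j <= n)%N -> T j w <= t%:E by rewrite arrival_countE// Nn.
have Tf j : (j <= n)%N -> T j w < +oo by move=> /Tt /le_lt_trans; apply; rewrite ltry.
have Ti := Tf _ (ltnW ni); have TSi := Tf _ ni.
rewrite /stepping -lte_fin -lee_fin !fineK ?arrival_fin_num//.
by rewrite Tt// andbT; exact: (arrival_lt HT).
Qed.

End Arrivals.

Section ArrivalLaw.
Context (d : measure_display) (Omega : measurableType d) (R : realType).
Variables (P : probability Omega R) (Lambda : {RV P >-> R})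
  (T : nat -> Omega -> \bar R) (N : R -> Omega -> nat).
Hypotheses (HT : claim_arrivals T N) (HN : mixed_poisson Lambda N).
Local Notation RM := (measurableTypeR R).
Local Notation leb := (@lebesgue_measure R).

(** The instants 0, a 0, b 0, a 1, b 1, ..., t. The l-th increment runs over the
    interval ]a i, b i] when l = 2 i + 1 and over a gap when l is even, so it
    must carry one claim exactly when l is odd. *)
Definition box_times n t (a b : nat -> R) (l : nat) : R :=
  if l is l'.+1 then
    if (l' < n.*2)%N then if odd l' then b l'./2 else a l'./2 else t
  else 0%R.

Lemma box_times_max n t a b : box_times n t a b n.*2.+1 = t.
Proof. by rewrite /box_times ltnn. Qed.

Lemma box_times_odd n t a b i : (i < n)%N -> box_times n t a b i.*2.+1 = a i.
Proof. by move=> ni; rewrite /= ltn_double ni odd_double doubleK. Qed.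

Lemma box_times_even n t a b i : (i < n)%N -> box_times n t a b i.*2.+2 = b i.
Proof.
by move=> ni; rewrite /= -doubleS leq_double ni odd_double /= uphalf_double.
Qed.

Lemma box_times_le n t a b l : (0 <= t)%R -> ordered_box n t a b ->
  (l < n.*2.+1)%N -> (box_times n t a b l <= box_times n t a b l.+1)%R.
Proof.
move=> t0 [a0 ab ba bt] ln.
have half k : (k < n.*2)%N -> (k./2 < n)%N.
  by rewrite ltn_half_double.
case: l ln => [_|l ln] /=.
  by case: ifP => // /half; apply: a0.
rewrite ltnS in ln; rewrite ln.
case: ltnP => ln1; last first.
  case: ifP => ol; first by apply: bt; exact: half.
  by apply: le_trans (bt _ (half _ ln)); apply: ab; exact: half.
rewrite /=; case: ifP => ol /=.
  by rewrite uphalf_half ol; apply: ba; have := half _ ln1; rewrite /= uphalf_half ol.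
by rewrite uphalf_half ol; apply: ab; exact: half.
Qed.

Lemma box_eventE n t a b : (0 < t)%R -> ordered_box n t a b ->
  [set w | N t w = n] `&` arrivals T n @^-1` box n a b =
  [set w | forall l, (l < n.*2.+1)%N ->
     N (box_times n t a b l.+1) w = (N (box_times n t a b l) w + odd l)%N].
Proof.
move=> t0 o; have [a0 ab ba bt] := o.
have Ncount w : (forall l, (l <= n.*2.+1)%N -> N (box_times n t a b l) w = l./2) <->
  N t w = n /\ box n a b (arrivals T n w).
  split.
    move=> H; split.
      by rewrite -(box_times_max n t a b) H//= uphalf_double.
    move=> i; rewrite /= in_itv /= tnth_mktuple.
    have Na : N (a i) w = i.
      rewrite -(box_times_odd t a b (ltn_ord i)) H//= ?uphalf_double//.
      by rewrite ltnS leq_double ltnW.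
    have Nb : N (b i) w = i.+1.
      rewrite -(box_times_even t a b (ltn_ord i)) H//= ?doubleK//.
      by rewrite ltnS ltn_double.
    have ai0 := a0 _ (ltn_ord i).
    have bi0 := le_trans ai0 (ab _ (ltn_ord i)).
    have Tb : T i.+1 w <= (b i)%:E by rewrite (arrival_countE HT)// Nb.
    rewrite -lte_fin -lee_fin fineK ?Tb ?andbT; last first.
      by rewrite (arrival_fin_num HT)// (le_lt_trans Tb)// ltry.
    by rewrite ltNge (arrival_countE HT)// Na ltnn.
  move=> [Nt Bw].
  have Tab i : (i < n)%N -> (a i)%:E < T i.+1 w <= (b i)%:E.
    move=> ni; have := Bw (Ordinal ni); rewrite /= in_itv /= tnth_mktuple /=.
    rewrite -lte_fin -lee_fin fineK// (arrival_fin_num HT)//.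
    have : T i.+1 w <= t%:E by rewrite (arrival_countE HT) ?Nt// ltW.
    by move=> /le_lt_trans; apply; rewrite ltry.
  have Na i : (i < n)%N -> N (a i) w = i.
    move=> ni; apply/eqP; rewrite eqn_leq -ltnS ltnNge -!(arrival_countE HT) ?a0//.
    have /andP[aT _] := Tab _ ni; rewrite -ltNge aT /=.
    case: i ni aT => [|i] ni aT; first by rewrite (arrival0 HT) lee_fin a0.
    have /andP[_ Tb] := Tab _ (ltnW ni).
    by apply: le_trans Tb _; rewrite lee_fin ba.
  have Nb i : (i < n)%N -> N (b i) w = i.+1.
    move=> ni; have bi0 : (0 <= b i)%R by apply: le_trans (a0 _ ni) (ab _ ni).
    have /andP[_ Tb] := Tab _ ni.
    apply/eqP; rewrite eqn_leq -ltnS ltnNge -!(arrival_countE HT)// Tb andbT -ltNge.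
    have [ni1|] := ltnP i.+1 n.
      have /andP[aT _] := Tab _ ni1.
      by apply: le_lt_trans aT; rewrite lee_fin ba.
    move=> ni1; have -> : i.+2 = n.+1 by congr S; apply/eqP; rewrite eqn_leq ni1 andbT.
    apply: (@le_lt_trans _ _ t%:E); first by rewrite lee_fin bt.
    by rewrite ltNge (arrival_countE HT) ?Nt ?ltnn// ltW.
  case=> [|l] ln; first by rewrite /= (count0 HT).
  rewrite ltnS leq_eqVlt in ln; case/orP: ln => [/eqP ->|ln].
    by rewrite box_times_max Nt /= uphalf_double.
  have hl : (l./2 < n)%N by rewrite ltn_half_double.
  rewrite /box_times ln /= uphalf_half; case: ifP => ol.
    by rewrite Nb.
  by rewrite Na.
apply/seteqP; split => w /=.
  move=> /Ncount H l ln; rewrite (H l.+1 ln) (H l (ltnW ln)).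
  by rewrite -[l.+1./2]/(uphalf l) uphalf_half addnC.
move=> H; apply/Ncount; elim=> [_|l IHl ln]; first by rewrite /= (count0 HT).
by rewrite H// IHl ?(ltnW ln)// -[l.+1./2]/(uphalf l) uphalf_half addnC.
Qed.

Lemma prod_odd (F : nat -> R) n :
  (\prod_(l < n.*2.+1) F l ^+ odd l = \prod_(i < n) F i.*2.+1)%R.
Proof.
elim: n => [|n IHn]; first by rewrite big_ord_recl !big_ord0 mulr1 expr0.
rewrite doubleS big_ord_recr big_ord_recr IHn [RHS]big_ord_recr /=.
by rewrite odd_double/= expr0 expr1 mulr1.
Qed.

(** The exponentials telescope to exp (- la t), and the n odd increments give
    la^n times the product of the lengths: apart from the Poisson weight of n
    claims before t, nothing depends on la. *)
Lemma box_weightE n t a b (la : R) : (0 < t)%R -> ordered_box n t a b ->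
  (\prod_(l < n.*2.+1) poisson_weight
     (la * (box_times n t a b l.+1 - box_times n t a b l)) (odd l) =
   (n`!%:R / t ^+ n * \prod_(i < n) (b i - a i)) * poisson_weight (la * t) n)%R.
Proof.
move=> t0 o; set s := box_times n t a b.
transitivity ((\prod_(l < n.*2.+1) (la * (s l.+1 - s l)) ^+ odd l) *
  \prod_(l < n.*2.+1) expR (- (la * (s l.+1 - s l))))%R.
  rewrite -big_split/=; apply: eq_bigr => l _; rewrite /poisson_weight.
  by case: (odd l); rewrite (_ : _`! = 1%N)// divr1.
rewrite (prod_odd (fun l => la * (s l.+1 - s l))%R) -expR_sum.
rewrite (_ : \sum_(l < _) _ = - (la * t))%R; last first.
  rewrite sumrN -mulr_sumr; congr (- (_ * _))%R.
  rewrite -(big_mkord xpredT (fun l => s l.+1 - s l))%R telescope_sumr//.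
  by rewrite /s box_times_max subr0.
rewrite /poisson_weight [RHS]mulrA; congr (_ * _)%R.
rewrite (eq_bigr (fun i : 'I_n => la * (b i - a i))%R); last first.
  by move=> i _; rewrite /s box_times_odd// box_times_even.
rewrite big_split/= prodr_const card_ord.
rewrite exprMn mulrC.
have t1 : (t ^+ n != 0)%R by rewrite expf_neq0// gt_eqF.
have n1 : (n`!%:R != 0 :> R)%R by rewrite pnatr_eq0 -lt0n fact_gt0.
by field; rewrite t1 n1.
Qed.

Lemma measurable_poisson_weight n (s : R) :
  measurable_fun setT (fun w => poisson_weight (Lambda w * s) n).
Proof.
rewrite /poisson_weight; apply: measurable_funM.
  apply: measurable_funM => //; apply: measurable_funX.
  exact: measurable_funM.
apply: measurableT_comp => //; apply: measurableT_comp => //.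
exact: measurable_funM.
Qed.

Lemma poisson_weight_ge0 (mu : R) n : (0 <= mu)%R -> (0 <= poisson_weight mu n)%R.
Proof. by move=> mu0; rewrite mulr_ge0 ?expR_ge0// divr_ge0 ?exprn_ge0. Qed.

Hypothesis Lambda_ge0 : forall w, (0 <= Lambda w)%R.

Lemma count_law n t : (0 < t)%R ->
  P [set w | N t w = n] = \int[P]_w (poisson_weight (Lambda w * t) n)%:E.
Proof.
move=> t0.
have := HN; move=> /(_ 1%N (fun l => if l is 0%N then 0%R else t) (fun=> n) setT).
rewrite preimage_setT setTI => H.
rewrite [LHS](_ : _ = P [set w | forall l, (l < 1)%N -> N t w =
  (N (if l is 0%N then 0%R else t) w + n)%N]); last first.
  congr (P _); apply/seteqP; split => w /=.
    by move=> Nt -[|l]//; rewrite (count0 HT).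
  by move=> /(_ 0%N erefl); rewrite (count0 HT).
rewrite [LHS]H//; last by move=> -[|l]//= _; exact: ltW.
by apply: eq_integral => w _; rewrite big_ord_recl big_ord0 mulr1 subr0.
Qed.

Lemma box_law n t a b : (0 < t)%R -> ordered_box n t a b ->
  P ([set w | N t w = n] `&` arrivals T n @^-1` box n a b) =
  (n`!%:R / t ^+ n * \prod_(i < n) (b i - a i))%:E * P [set w | N t w = n].
Proof.
move=> t0 o.
have := HN; move=> /(_ n.*2.+1 (box_times n t a b) (fun l => odd l) setT).
rewrite preimage_setT setTI => H.
rewrite box_eventE// [LHS]H//; last by move=> l ln; apply: box_times_le; rewrite ?ltW.
rewrite count_law// -ge0_integralZl_EFin//.
- apply: eq_integral => w _; rewrite -EFinM; congr EFin; exact: box_weightE.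
- by move=> w _; rewrite lee_fin poisson_weight_ge0// mulr_ge0// ltW.
- exact/measurable_EFinP/measurable_poisson_weight.
- have [a0 ab _ _] := o.
  apply: mulr_ge0; first by rewrite divr_ge0// exprn_ge0// ltW.
  by apply: prodr_ge0 => i _; rewrite subr_ge0 ab.
Qed.

(** The conditional uniformity of the arrival times. On ordered boxes the factor
    free of Lambda comes out of the integral over Lambda, and both sides are
    finite measures of A. *)
Theorem arrivals_law n t A : (0 < t)%R -> measurable A ->
  P ([set w | N t w = n] `&` arrivals T n @^-1` A) =
  (n`!%:R / t ^+ n)%:E * P [set w | N t w = n] *
  tuple_measure leb n (A `&` simplex n t 0%R).
Proof.
move=> t0 mA; pose E := [set w | N t w = n].
have mE : measurable E by apply: (measurable_count HT); exact: ltW.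
have c0 : (0 <= n`!%:R / t ^+ n * fine (P E))%R.
  by rewrite mulr_ge0 ?fine_ge0// divr_ge0// exprn_ge0// ltW.
pose c := NngNum c0.
have mar := @measurable_arrivals _ _ _ _ _ HT n.
pose m1 := measure_function_pushforward__canonical__measure_function_Measure
  (mrestr P mE) mar.
pose m2 : {measure set (n.-tuple RM) -> \bar R} := mscale c (tuple_measure leb n).
have m1E B : m1 B = P (E `&` arrivals T n @^-1` B) by rewrite setIC.
have m2E B : m2 B = (n`!%:R / t ^+ n)%:E * P E * tuple_measure leb n B.
  by rewrite -[P E]fineK ?fin_num_measure.
transitivity (m1 (A `&` simplex n t 0%R)).
  rewrite m1E; congr (P _); apply/seteqP; split => w /= [Nw]; last by case.
  move=> Aw; do 2 split => //; apply: (arrivals_simplex HT) => //; exact: ltW.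
rewrite -[RHS]m2E; apply: simplex_measure_unique => // a b o.
  rewrite m1E [LHS]box_law// m2E (@tuple_measure_box _ _ _ leb n
    (fun i => `]a i, b i]%classic))//.
  rewrite (eq_bigr (fun i : 'I_n => (b i - a i)%:E)); last first.
    move=> i _; change (leb `]a i, b i] = (b i - a i)%:E).
    rewrite lebesgue_measure_itv /= lte_fin.
    case: o => _ ab _ _; have := ab _ (ltn_ord i); rewrite le_eqVlt.
    by case/predU1P => [->|->//]; rewrite ltxx subrr.
  by rewrite -(big_morph EFin EFinM erefl) EFinM muleAC.
rewrite m1E (le_lt_trans (probability_le1 P _)) ?ltry//.
apply: measurableI => //; rewrite -[X in measurable X]setTI.
by apply: (mar) => //; exact: measurable_box.
Qed.

End ArrivalLaw.

(** * Marginals of the uniform law on the simplex *)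

Section Marginals.
Context (R : realType).
Local Notation RM := (measurableTypeR R).
Local Notation leb := (@lebesgue_measure R).
Implicit Types (t a x : R) (f : seq R -> \bar R).

Lemma lebesgue_measure_shift a (A : set RM) : measurable A ->
  pushforward leb (fun u : RM => (a + u)%R : RM) A = leb A.
Proof.
move=> mA; apply/esym.
have ms : measurable_fun [set: RM] (fun u : RM => (a + u)%R : RM).
  exact: measurable_funD.
apply: (@lebesgue_measure_unique _
  (measure_function_pushforward__canonical__measure_function_Measure leb ms))
  => //= _ [[b c]] _ <-.
rewrite /pushforward (_ : _ @^-1` _ = `](b - a)%R, (c - a)%R]%classic); last first.
  apply/seteqP; split => u /=; rewrite !in_itv/= => /andP[bu uc];
  apply/andP; split; lra.
rewrite /= !lebesgue_measure_itv/= !lte_fin ltrD2r; case: ifP => // _.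
by rewrite -!EFinB; congr EFin; lra.
Qed.

Lemma ge0_integral_shift t a (h : RM -> \bar R) :
  measurable_fun [set: RM] h -> (forall x, 0 <= h x) ->
  \int[leb]_(y in `[a, t]) h y = \int[leb]_(u in `[0%R, (t - a)%R]) h (a + u)%R.
Proof.
move=> mh h0.
have ms : measurable_fun [set: RM] (fun u : RM => (a + u)%R : RM).
  exact: measurable_funD.
rewrite (_ : `[0%R, (t - a)%R]%classic =
    (fun u : RM => (a + u)%R : RM) @^-1` `[a, t]%classic); last first.
  apply/seteqP; split => u /=; rewrite !in_itv/= => /andP[bu uc];
  apply/andP; split; lra.
rewrite -[RHS](@ge0_integral_pushforward _ _ _ _ _ _ ms leb `[a, t]%classic h)//.
- by apply: eq_measure_integral => A mA _; exact/esym/lebesgue_measure_shift.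
- exact: measurable_funTS.
Qed.

Lemma seq_measurableZl f (c : R) : seq_measurable f ->
  seq_measurable (fun s => c%:E * f s).
Proof. by move=> mf n; apply: emeasurable_funM => //; exact: mf. Qed.

Lemma simplex_integralZl n t a f (c : R) :
  seq_measurable f -> (forall s, 0 <= f s) -> (0 <= c)%R ->
  simplex_integral n t a (fun s => c%:E * f s) = c%:E * simplex_integral n t a f.
Proof.
move=> mf f0 c0; rewrite /simplex_integral ge0_integralZl_EFin//.
- exact: measurable_simplex.
- by apply: measurable_funTS; exact: (mf n).
Qed.

(** The weight is put back into the integrand, which keeps all the factors in
    one place when several groups of coordinates are skipped in turn. *)
Lemma simplex_integral_skipW m k t a f :
  seq_measurable f -> (forall s, 0 <= f s) ->
  simplex_integral (m.+1 + k) t a (fun s => f (drop m s)) =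
  \int[leb]_(x in `[a, t])
    simplex_integral k t x (fun s => (divpow m (x - a))%:E * f (x :: s)).
Proof.
move=> mf f0; rewrite simplex_integral_skip//; apply: eq_integral => x.
rewrite inE /= in_itv /= => /andP[ax _].
rewrite -(simplex_integralZl _ _ _ (seq_measurable_cons1 x mf))//.
by rewrite divpow_ge0// subr_ge0.
Qed.

Lemma simplex_integral_shift k t a f :
  seq_measurable f -> (forall s, 0 <= f s) ->
  simplex_integral k.+1 t a f =
  \int[leb]_(u in `[0%R, (t - a)%R])
    simplex_integral k t (a + u) (fun s => f ((a + u)%R :: s)).
Proof.
move=> mf f0; rewrite simplex_integralS// ge0_integral_shift//.
  exact: measurable_simplex_integral.
by move=> x; exact: simplex_integral_ge0.
Qed.

Lemma seq_measurable_nth i n :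
  measurable_fun setT (fun v : n.-tuple RM => nth 0%R v i : R).
Proof.
have [ni|ni] := ltnP i n.
  rewrite (_ : (fun _ => _) = (@tnth n RM)^~ (Ordinal ni)).
    exact: measurable_tnth.
  by apply/funext => v; rewrite (tnth_nth (0%R : R)).
rewrite (_ : (fun _ => _) = cst 0%R); first exact: measurable_cst.
by apply/funext => v; rewrite nth_default// size_tuple.
Qed.

End Marginals.

Section SeqFunctions.
Context (R : realType).
Local Notation RM := (measurableTypeR R).

Lemma seq_measurable_comp d (U : measurableType d) (p : U -> \bar R)
    (z : seq R -> U) : measurable_fun setT p ->
  (forall n, measurable_fun setT (fun v : n.-tuple RM => z v)) ->
  seq_measurable (fun s => p (z s)).
Proof. by move=> mp mz n; exact: (measurableT_comp mp (mz n)). Qed.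

Lemma measurable_nth_cons0 n (x : R) (z : n.-tuple RM -> seq R) :
  measurable_fun setT (fun v : n.-tuple RM => nth (0%R : R) (x :: z v) 0%N).
Proof. exact: measurable_cst. Qed.

Lemma measurable_nth_consS n (x : R) (z : n.-tuple RM -> seq R) i :
  measurable_fun setT (fun v : n.-tuple RM => nth (0%R : R) (z v) i) ->
  measurable_fun setT (fun v : n.-tuple RM => nth (0%R : R) (x :: z v) i.+1).
Proof. by []. Qed.

End SeqFunctions.

(* The integrands are local definitions; their bodies have to be exposed before
   measurability or sign can be decided from their shape. *)
Ltac unfold_seq_fun := repeat match goal with
  | g := _ : (seq _ -> _)%type |- _ => progress unfold g end.

Ltac seq_meas := unfold_seq_fun;
  repeat apply: seq_measurableZl; apply: seq_measurable_comp => // ?;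
  do ?[apply: measurable_fun_pair | apply: measurable_funB
      | exact: seq_measurable_nth | exact: measurable_nth_cons0
      | apply: measurable_nth_consS | exact: measurable_cst].

Ltac nonneg := unfold_seq_fun; move=> *; repeat apply: mule_ge0 => //;
  rewrite ?lee_fin ?divpow_ge0 ?subr_ge0 ?subr0 //.

Section MarginalFormulas.
Context (R : realType).
Local Notation leb := (@lebesgue_measure R).
Local Notation "s `_[ i ]" := (nth (0%R : R) s i) (at level 3, format "s `_[ i ]").
Implicit Types (t : R).

(** The k coordinates above y have volume (t - y)^k / k!. Here and below K
    gathers the constants: it is moved under the integrals at the start, so that
    only one product of reals has to be simplified at the end. *)
Lemma simplex_marginal_first t k (p : R -> \bar R) : (0 < t)%R ->
  measurable_fun setT p -> (forall z, 0 <= p z) ->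
  (k.+1`!%:R / t ^+ k.+1)%:E *
    simplex_integral k.+1 t 0%R (fun s => p s`_[0%N]) =
  k.+1%:R%:E * \int[leb]_(y in `[0%R, t])
    (p y * ((t - y) ^+ k / t ^+ k.+1)%:E).
Proof.
move=> t0 mp p0.
have tn0 : (t ^+ k.+1 != 0)%R by rewrite expf_neq0// gt_eqF.
have k0 : (k`!%:R != 0 :> R)%R by rewrite pnatr_eq0 -lt0n fact_gt0.
pose K : R := (k`!%:R / t ^+ k.+1)%R.
have K0 : (0 <= K)%R by rewrite divr_ge0// exprn_ge0// ltW.
have -> : (k.+1`!%:R / t ^+ k.+1 = k.+1%:R * K)%R.
  by rewrite /K factS natrM mulrA.
rewrite EFinM -muleA; congr (_ * _); rewrite -simplex_integralZl//; last first.
  by seq_meas.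
rewrite simplex_integralS; [|by seq_meas|by nonneg].
apply: eq_integral => y; rewrite inE/= in_itv/= => /andP[y0 yt].
rewrite simplex_integral_cst//; last by nonneg.
rewrite muleCA muleA muleC -EFinM; congr (_ * _%:E).
by rewrite /K /divpow; field; rewrite tn0 k0.
Qed.

(** The m coordinates below x are skipped, the next coordinate is x + v, and the
    last k range over the simplex above x + v. *)
Lemma simplex_marginal_pair t m k (p : R * R -> \bar R) : (0 < t)%R ->
  measurable_fun setT p -> (forall z, 0 <= p z) ->
  ((m.+1 + k.+1)`!%:R / t ^+ (m.+1 + k.+1))%:E *
    simplex_integral (m.+1 + k.+1) t 0%R
      (fun s => p (s`_[m], s`_[m.+1] - s`_[m])%R) =
  ((m.+1 + k.+1)`!%:R / (m`! * k`!)%N%:R)%:E *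
    \int[leb]_(x in `[0%R, t]) \int[leb]_(v in `[0%R, (t - x)%R])
      (p (x, v) * (x ^+ m * (t - x - v) ^+ k / t ^+ (m.+1 + k.+1))%:E).
Proof.
move=> t0 mp p0; set n := (m.+1 + k.+1)%N.
have tn0 : (t ^+ n != 0)%R by rewrite expf_neq0// gt_eqF.
have k0 : (k`!%:R != 0 :> R)%R by rewrite pnatr_eq0 -lt0n fact_gt0.
have m0 : (m`!%:R != 0 :> R)%R by rewrite pnatr_eq0 -lt0n fact_gt0.
pose K : R := ((m`! * k`!)%N%:R / t ^+ n)%R.
have K0 : (0 <= K)%R by rewrite divr_ge0// exprn_ge0// ltW.
have -> : (n`!%:R / t ^+ n = n`!%:R / (m`! * k`!)%N%:R * K)%R.
  by rewrite /K natrM; field; rewrite tn0 k0 m0.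
rewrite EFinM -muleA; congr (_ * _); rewrite -simplex_integralZl//; last first.
  by seq_meas.
pose g (s : seq R) := K%:E * p (s`_[0%N], s`_[1%N] - s`_[0%N])%R.
rewrite (_ : (fun s => _) = (fun s => g (drop m s))); last first.
  by apply/funext => s; rewrite /g !nth_drop addn0 addn1.
rewrite simplex_integral_skipW; [|by seq_meas|by nonneg].
apply: eq_integral => x; rewrite inE/= in_itv/= => /andP[x0 xt].
rewrite simplex_integral_shift; [|by seq_meas|by nonneg].
apply: eq_integral => v; rewrite inE/= in_itv/= => /andP[v0 vt].
have xvt : (x + v <= t)%R by lra.
rewrite /g /= simplex_integral_cst//; last by nonneg.
rewrite addrAC subrr add0r !muleA -!EFinM muleC; congr (_ * _%:E).
by rewrite /K /divpow natrM subr0 opprD addrA; field; rewrite tn0 k0 m0.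
Qed.

(** Coordinates are skipped between y and w and above w + v. *)
Lemma simplex_marginal_first_pair t l k (p : R * R * R -> \bar R) : (0 < t)%R ->
  measurable_fun setT p -> (forall z, 0 <= p z) ->
  let n := (l.+1 + k.+1).+1 in
  (n`!%:R / t ^+ n)%:E *
    simplex_integral n t 0%R
      (fun s => p (s`_[0%N], s`_[l.+1], s`_[l.+2] - s`_[l.+1])%R) =
  (n`!%:R / (l`! * k`!)%N%:R)%:E *
    \int[leb]_(y in `[0%R, t]) \int[leb]_(w in `[y, t])
    \int[leb]_(v in `[0%R, (t - w)%R])
      (p (y, w, v) * ((w - y) ^+ l * (t - w - v) ^+ k / t ^+ n)%:E).
Proof.
move=> t0 mp p0 n.
have tn0 : (t ^+ n != 0)%R by rewrite expf_neq0// gt_eqF.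
have k0 : (k`!%:R != 0 :> R)%R by rewrite pnatr_eq0 -lt0n fact_gt0.
have m0 : (l`!%:R != 0 :> R)%R by rewrite pnatr_eq0 -lt0n fact_gt0.
pose K : R := ((l`! * k`!)%N%:R / t ^+ n)%R.
have K0 : (0 <= K)%R by rewrite divr_ge0// exprn_ge0// ltW.
have -> : (n`!%:R / t ^+ n = n`!%:R / (l`! * k`!)%N%:R * K)%R.
  by rewrite /K natrM; field; rewrite tn0 k0 m0.
rewrite EFinM -muleA; congr (_ * _); rewrite -simplex_integralZl//; last first.
  by seq_meas.
rewrite simplex_integralS; [|by seq_meas|by nonneg].
apply: eq_integral => y; rewrite inE/= in_itv/= => /andP[y0 yt].
pose g (s : seq R) := K%:E * p (y, s`_[0%N], s`_[1%N] - s`_[0%N])%R.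
rewrite (_ : (fun s => _) = (fun s => g (drop l s))); last first.
  by apply/funext => s; rewrite /g !nth_drop addn0 addn1.
rewrite simplex_integral_skipW; [|by seq_meas|by nonneg].
apply: eq_integral => w; rewrite inE/= in_itv/= => /andP[yw wt].
rewrite simplex_integral_shift; [|by seq_meas|by nonneg].
apply: eq_integral => v; rewrite inE/= in_itv/= => /andP[v0 vt].
have wvt : (w + v <= t)%R by lra.
rewrite /g /= simplex_integral_cst//; last by nonneg.
rewrite (addrAC w) subrr add0r !muleA -!EFinM muleC; congr (_ * _%:E).
by rewrite /K /divpow natrM opprD addrA; field; rewrite tn0 k0 m0.
Qed.

(** Two successive translations: the retained coordinates are y, y + u and
    y + u + v. *)
Lemma simplex_marginal_consecutive t m k (p : R * R * R -> \bar R) : (0 < t)%R ->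
  measurable_fun setT p -> (forall z, 0 <= p z) ->
  let n := (m.+1 + k.+2)%N in
  (n`!%:R / t ^+ n)%:E *
    simplex_integral n t 0%R
      (fun s => p (s`_[m], s`_[m.+1] - s`_[m], s`_[m.+2] - s`_[m.+1])%R) =
  (n`!%:R / (m`! * k`!)%N%:R)%:E *
    \int[leb]_(y in `[0%R, t]) \int[leb]_(u in `[0%R, (t - y)%R])
    \int[leb]_(v in `[0%R, (t - y - u)%R])
      (p (y, u, v) * (y ^+ m * (t - y - u - v) ^+ k / t ^+ n)%:E).
Proof.
move=> t0 mp p0 n.
have tn0 : (t ^+ n != 0)%R by rewrite expf_neq0// gt_eqF.
have k0 : (k`!%:R != 0 :> R)%R by rewrite pnatr_eq0 -lt0n fact_gt0.
have m0 : (m`!%:R != 0 :> R)%R by rewrite pnatr_eq0 -lt0n fact_gt0.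
pose K : R := ((m`! * k`!)%N%:R / t ^+ n)%R.
have K0 : (0 <= K)%R by rewrite divr_ge0// exprn_ge0// ltW.
have -> : (n`!%:R / t ^+ n = n`!%:R / (m`! * k`!)%N%:R * K)%R.
  by rewrite /K natrM; field; rewrite tn0 k0 m0.
rewrite EFinM -muleA; congr (_ * _); rewrite -simplex_integralZl//; last first.
  by seq_meas.
pose g (s : seq R) := K%:E * p (s`_[0%N], s`_[1%N] - s`_[0%N], s`_[2] - s`_[1%N])%R.
rewrite (_ : (fun s => _) = (fun s => g (drop m s))); last first.
  by apply/funext => s; rewrite /g !nth_drop addn0 addn1 addn2.
rewrite simplex_integral_skipW; [|by seq_meas|by nonneg].
apply: eq_integral => y; rewrite inE/= in_itv/= => /andP[y0 yt].
rewrite simplex_integral_shift; [|by seq_meas|by nonneg].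
apply: eq_integral => u; rewrite inE/= in_itv/= => /andP[u0 ut].
rewrite simplex_integral_shift; [|by seq_meas|by nonneg].
rewrite opprD addrA; apply: eq_integral => v; rewrite inE/= in_itv/= => /andP[v0 vt].
have yuvt : (y + u + v <= t)%R by lra.
rewrite /g /= simplex_integral_cst//; last by nonneg.
have -> : (y + u - y = u)%R by rewrite addrAC subrr add0r.
have -> : (y + u + v - (y + u) = v)%R by rewrite addrAC subrr add0r.
rewrite !muleA -!EFinM muleC; congr (_ * _%:E).
by rewrite /K /divpow natrM subr0 !opprD !addrA; field; rewrite tn0 k0 m0.
Qed.

(** Coordinates are skipped below x, between x + u and w, and above w + v. *)
Lemma simplex_marginal_two_pairs t m l k (p : R * R * R * R -> \bar R) : (0 < t)%R ->
  measurable_fun setT p -> (forall z, 0 <= p z) ->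
  let n := (m.+1 + (l.+1 + k.+1).+1)%N in
  (n`!%:R / t ^+ n)%:E *
    simplex_integral n t 0%R
      (fun s => p (s`_[m], s`_[m.+1] - s`_[m],
         s`_[(m + l.+2)%N], s`_[(m + l.+3)%N] - s`_[(m + l.+2)%N])%R) =
  (n`!%:R / (m`! * l`! * k`!)%N%:R)%:E *
    \int[leb]_(x in `[0%R, t]) \int[leb]_(u in `[0%R, (t - x)%R])
    \int[leb]_(w in `[(x + u)%R, t]) \int[leb]_(v in `[0%R, (t - w)%R])
      (p (x, u, w, v) *
       (x ^+ m * (w - x - u) ^+ l * (t - w - v) ^+ k / t ^+ n)%:E).
Proof.
move=> t0 mp p0 n.
have tn0 : (t ^+ n != 0)%R by rewrite expf_neq0// gt_eqF.
have k0 : (k`!%:R != 0 :> R)%R by rewrite pnatr_eq0 -lt0n fact_gt0.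
have m0 : (m`!%:R != 0 :> R)%R by rewrite pnatr_eq0 -lt0n fact_gt0.
have l0 : (l`!%:R != 0 :> R)%R by rewrite pnatr_eq0 -lt0n fact_gt0.
pose K : R := ((m`! * l`! * k`!)%N%:R / t ^+ n)%R.
have K0 : (0 <= K)%R by rewrite divr_ge0// exprn_ge0// ltW.
have -> : (n`!%:R / t ^+ n = n`!%:R / (m`! * l`! * k`!)%N%:R * K)%R.
  by rewrite /K !natrM; field; rewrite tn0 k0 m0 l0.
rewrite EFinM -muleA; congr (_ * _); rewrite -simplex_integralZl//; last first.
  by seq_meas.
pose g (s : seq R) := K%:E *
  p (s`_[0%N], s`_[1%N] - s`_[0%N], s`_[l.+2], s`_[l.+3] - s`_[l.+2])%R.
rewrite (_ : (fun s => _) = (fun s => g (drop m s))); last first.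
  by apply/funext => s; rewrite /g !nth_drop addn0 addn1.
rewrite simplex_integral_skipW; [|by seq_meas|by nonneg].
apply: eq_integral => x; rewrite inE/= in_itv/= => /andP[x0 xt].
rewrite simplex_integral_shift; [|by seq_meas|by nonneg].
apply: eq_integral => u; rewrite inE/= in_itv/= => /andP[u0 ut].
pose g' (s : seq R) := (divpow m (x - 0))%:E *
  (K%:E * p (x, x + u - x, s`_[0%N], s`_[1%N] - s`_[0%N])%R).
rewrite (_ : (fun s => _) = (fun s => g' (drop l s))); last first.
  by apply/funext => s; rewrite /g' !nth_drop addn0 addn1.
rewrite simplex_integral_skipW; [|by seq_meas|by nonneg].
apply: eq_integral => w; rewrite inE/= in_itv/= => /andP[xuw wt].
rewrite simplex_integral_shift; [|by seq_meas|by nonneg].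
apply: eq_integral => v; rewrite inE/= in_itv/= => /andP[v0 vt].
have wvt : (w + v <= t)%R by lra.
rewrite /g' /= simplex_integral_cst//; last by nonneg.
have -> : (x + u - x = u)%R by rewrite addrAC subrr add0r.
have -> : (w + v - w = v)%R by rewrite addrAC subrr add0r.
rewrite !muleA -!EFinM muleC; congr (_ * _%:E).
by rewrite /K /divpow !natrM subr0 !opprD !addrA; field; rewrite tn0 k0 m0 l0.
Qed.

End MarginalFormulas.

(** * Iterated integrals of a difference *)

Lemma maxe_oppB_le (R : realType) (a b : \bar R) : 0 <= a -> 0 <= b ->
  maxe (- (a - b)) 0 <= b.
Proof.
move=> a0 b0; rewrite ge_max b0 andbT.
case: a b a0 b0 => [a| |] [b| |] //=; rewrite ?leey ?leNye// !lee_fin => a0 b0.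
by rewrite opprB gerBl.
Qed.

(** For f = a - b: f^+ + b = a + f^-, an identity between sums of nonnegative
    terms that survives a = +oo. *)
Lemma maxeB_add (R : realType) (a b : \bar R) : 0 <= a -> b \is a fin_num ->
  maxe (a - b) 0 + b = a + maxe (- (a - b)) 0.
Proof.
case: b => [b| |]//; case: a => [a| |]// a0 _; last first.
  by rewrite /= maxye maxNye.
rewrite -EFinB -EFinN -!EFin_max -!EFinD; congr EFin.
have [ab|ab] := leP (a - b)%R 0%R; first by rewrite max_l; lra.
by rewrite max_r; lra.
Qed.

Section SplitIntegral.
Context d (T : measurableType d) (R : realType).
Variable m : {measure set T -> \bar R}.
Implicit Types (D : set T) (f p n : T -> \bar R).

(** Integration of a difference p - n in which p may have infinite integral. The
    signs are only asked on D, because the polynomial weights of the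
    coefficients change sign outside the domain of integration. *)
Record splits D f p n : Prop := Splits {
  splits_mf : measurable_fun setT f;
  splits_mp : measurable_fun setT p;
  splits_mn : measurable_fun setT n;
  splits_p0 : forall x, D x -> 0 <= p x;
  splits_n0 : forall x, D x -> 0 <= n x;
  splits_noo : \int[m]_(x in D) n x < +oo;
  splits_ae : {ae m, forall x, D x -> f x = p x - n x} }.

Lemma splits_integral D f p n : measurable D -> splits D f p n ->
  \int[m]_(x in D) f x = \int[m]_(x in D) p x - \int[m]_(x in D) n x.
Proof.
move=> mD [mf mp mn p0 n0 noo fpn].
have mfD : measurable_fun D f by exact: measurable_funTS.
have mpD : measurable_fun D p by exact: measurable_funTS.
have mnD : measurable_fun D n by exact: measurable_funTS.
have mfp : measurable_fun D f^\+ by exact: measurable_funepos.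
have mfn : measurable_fun D f^\- by exact: measurable_funeneg.
have In : m.-integrable D n.
  apply/integrableP; split=> //.
  by under eq_integral => x /[!inE] xD do rewrite gee0_abs ?n0//.
have nfin : {ae m, forall x, D x -> n x \is a fin_num} by exact: integrable_ae.
have fneg_le : {ae m, forall x, D x -> f^\- x <= n x}.
  apply: filterS fpn => x fE Dx.
  by rewrite funenegE fE//; apply: maxe_oppB_le; [exact: p0|exact: n0].
have fnoo : \int[m]_(x in D) f^\- x < +oo.
  by apply: le_lt_trans noo; apply: ae_ge0_le_integral.
(* Negative parts are moved across, so that only nonnegative functions are
   added. *)
have E : \int[m]_(x in D) f^\+ x + \int[m]_(x in D) n x =
         \int[m]_(x in D) p x + \int[m]_(x in D) f^\- x.
  rewrite -!ge0_integralD//.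
  apply: ge0_ae_eq_integral => //.
  - exact: emeasurable_funD.
  - exact: emeasurable_funD.
  - by move=> x Dx; rewrite adde_ge0// n0.
  - by move=> x Dx; rewrite adde_ge0// p0.
  - apply: filterS2 fpn nfin => x fE nf Dx.
    by rewrite funeposE funenegE fE// maxeB_add ?p0 ?nf.
have nf : \int[m]_(x in D) n x \is a fin_num.
  by rewrite ge0_fin_numE// integral_ge0.
have ff : \int[m]_(x in D) f^\- x \is a fin_num.
  by rewrite ge0_fin_numE// integral_ge0.
rewrite integralE -(addeK (\int[m]_(x in D) f^\+ x) nf) E.
by rewrite addeAC addeK.
Qed.

End SplitIntegral.

Section DependentDomain.
Context d1 d2 (X : measurableType d1) (Y : measurableType d2) (R : realType).
Variables (m1 : {sigma_finite_measure set X -> \bar R})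
  (m2 : {sigma_finite_measure set Y -> \bar R}).
Implicit Types (D : set X) (E : X -> set Y) (f p n : X * Y -> \bar R).

(** The domain of an iterated integral whose inner bounds depend on the outer
    variable. *)
Definition dep_set D E : set (X * Y) := [set z | D z.1 /\ E z.1 z.2].

Lemma measurable_dep_set D E : measurable D -> measurable (dep_set setT E) ->
  measurable (dep_set D E).
Proof.
move=> mD mE; rewrite (_ : dep_set D E = (D `*` setT) `&` dep_set setT E).
  by apply: measurableI => //; exact: measurableX.
apply/seteqP; split => z /=; first by move=> [? ?].
by move=> [[? _] []].
Qed.

Lemma measurable_dep_section E x : measurable (dep_set setT E) ->
  measurable (E x).
Proof.
move=> /(measurable_xsection x); congr measurable.
apply/seteqP; split => y; rewrite /xsection /= inE; last by split.
by move=> [].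
Qed.

Lemma dep_integral_patchE E f x :
  \int[m2]_(y in E x) f (x, y) = \int[m2]_y (f \_ (dep_set setT E)) (x, y).
Proof.
rewrite integral_mkcond; apply: eq_integral => y _; rewrite /patch.
suff -> : (y \in E x) = ((x, y) \in dep_set setT E) by [].
by apply/idP/idP => /set_mem H; apply/mem_set => //; case: H.
Qed.

Lemma measurable_dep_integral E f : measurable (dep_set setT E) ->
  measurable_fun setT f ->
  measurable_fun setT (fun x => \int[m2]_(y in E x) f (x, y)).
Proof.
move=> mE mf; pose h := f \_ (dep_set setT E).
have mh : measurable_fun setT h by exact: measurable_patch.
rewrite (_ : (fun x => _) = (fun x =>
   \int[m2]_y h^\+ (x, y) - \int[m2]_y h^\- (x, y))).
  apply: emeasurable_funB.
    by apply: (measurable_fun_fubini_tonelli_F h^\+) => //; exact: measurable_funepos.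
  by apply: (measurable_fun_fubini_tonelli_F h^\-) => //; exact: measurable_funeneg.
apply/funext => x; rewrite dep_integral_patchE integralE.
by congr (_ - _); apply: eq_integral => y _; rewrite ?funeposE ?funenegE.
Qed.

Lemma ge0_dep_integral D E p : measurable D -> measurable (dep_set setT E) ->
  measurable_fun setT p -> (forall z, dep_set D E z -> 0 <= p z) ->
  \int[prod_measure m1 m2]_(z in dep_set D E) p z =
  \int[m1]_(x in D) \int[m2]_(y in E x) p (x, y).
Proof.
move=> mD mE mp p0; have mDE := measurable_dep_set mD mE.
rewrite integral_mkcond [LHS]fubini_tonelli1; last 2 first.
- exact: measurable_patch.
- by move=> z; exact: erestrict_ge0.
rewrite [RHS]integral_mkcond; apply: eq_integral => x _; rewrite [RHS]patchE.
case: ifPn => [/set_mem Dx|/negP Dx].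
  rewrite [RHS]integral_mkcond; apply: eq_integral => y _; rewrite /patch.
  suff -> : (y \in E x) = ((x, y) \in dep_set D E) by [].
  by apply/idP/idP => /set_mem H; apply/mem_set => //; case: H.
apply: integral0_eq => y _; rewrite /patch; case: ifPn => // /set_mem [Dx' _].
by exfalso; apply: Dx; exact/mem_set.
Qed.

(** Integrating out the innermost variable preserves a splitting. For almost
    every x the section of n has finite integral and the section of the
    exceptional set is null, so the one-variable rule applies to the section. *)
Lemma splits_dep_integral D E f p n : measurable D ->
  measurable (dep_set setT E) ->
  splits (prod_measure m1 m2) (dep_set D E) f p n ->
  splits m1 D (fun x => \int[m2]_(y in E x) f (x, y))
    (fun x => \int[m2]_(y in E x) p (x, y))
    (fun x => \int[m2]_(y in E x) n (x, y)).
Proof.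
move=> mD mE [mf mp mn p0 n0 noo fpn].
have p0' x : D x -> 0 <= \int[m2]_(y in E x) p (x, y).
  by move=> Dx; apply: integral_ge0 => y Ey; exact: p0.
have n0' x : D x -> 0 <= \int[m2]_(y in E x) n (x, y).
  by move=> Dx; apply: integral_ge0 => y Ey; exact: n0.
have mn' := measurable_dep_integral mE mn.
have noo' : \int[m1]_(x in D) \int[m2]_(y in E x) n (x, y) < +oo.
  by rewrite -ge0_dep_integral.
split => //; [exact: measurable_dep_integral..|].
have In : m1.-integrable D (fun x => \int[m2]_(y in E x) n (x, y)).
  apply/integrableP; split; first exact: measurable_funTS.
  by under eq_integral => x /[!inE] xD do rewrite gee0_abs ?n0'//.
have nfin := integrable_ae mD In.
case: fpn => A [mA A0 subA].
(* By Tonelli the measure of A is the integral of that of its sections. *)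
have sec0 : {ae m1, forall x, m2 (xsection A x) = 0}.
  have mx : measurable_fun setT (m2 \o xsection A) by exact: measurable_fun_xsection.
  have : ae_eq m1 setT (m2 \o xsection A) (cst 0).
    apply/ae_eq_integral_abs => //.
    rewrite -[RHS]A0; apply: eq_integral => x _.
    by rewrite /= gee0_abs.
  by apply: filterS => x /(_ I).
apply: filterS2 nfin sec0 => x nfx secx Dx.
have mEx := measurable_dep_section x mE.
have mpair (h : X * Y -> \bar R) : measurable_fun setT h ->
    measurable_fun setT (fun y => h (x, y)).
  by move=> mh; exact: (measurableT_comp mh (measurable_pair1 x)).
apply: splits_integral => //; split; [exact: mpair..| | | |].
- by move=> y Ey; exact: p0.
- by move=> y Ey; exact: n0.
- by have := nfx Dx; rewrite ge0_fin_numE// n0'.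
- exists (xsection A x); split => //; first exact: measurable_xsection.
  move=> y /= H; rewrite /xsection /= inE; apply: subA => /= K.
  by apply: H => Ey; exact: K.
Qed.

End DependentDomain.

Section Represents.
Context (R : realType).

(** J is integration over D against m, written in another form. An iterated
    integral need not agree with the integral against the product measure when
    the integrand changes sign; the two clauses retain what does hold, for
    nonnegative integrands and for differences with a finite second term. *)
Definition represents d (U : measurableType d) (m : {measure set U -> \bar R})
    (D : set U) (J : (U -> \bar R) -> \bar R) :=
  (forall p, measurable_fun setT p -> (forall u, D u -> 0 <= p u) ->
     J p = \int[m]_(u in D) p u) /\
  (forall f p n, splits m D f p n -> J f = J p - J n).

Lemma represents_integral d (U : measurableType d)
    (m : {measure set U -> \bar R}) (D : set U) : measurable D ->
  represents m D (fun f => \int[m]_(u in D) f u).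
Proof. by move=> mD; split => // f p n; exact: splits_integral. Qed.

(** The induction step that builds iterated integrals with variable bounds one
    innermost variable at a time. *)
Lemma represents_dep d1 d2 (X : measurableType d1) (Y : measurableType d2)
    (m1 : {sigma_finite_measure set X -> \bar R})
    (m2 : {sigma_finite_measure set Y -> \bar R})
    (D : set X) (E : X -> set Y) (J : (X -> \bar R) -> \bar R) :
  measurable D -> measurable (dep_set setT E) -> represents m1 D J ->
  represents (prod_measure m1 m2) (dep_set D E)
    (fun f => J (fun x => \int[m2]_(y in E x) f (x, y))).
Proof.
move=> mD mE [J0 Js]; split => [p mp p0|f p n S].
  rewrite J0; first by rewrite ge0_dep_integral.
  - exact: measurable_dep_integral.
  - by move=> x Dx; apply: integral_ge0 => y Ey; exact: p0.
by apply: Js; exact: splits_dep_integral.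
Qed.

(** The operator I respects differences. The exceptional set is measured by I
    itself: the regression functions satisfy f = p - n almost surely for the law
    of the times, which is only known through I. *)
Definition splitting d (U : measurableType d) (I : (U -> \bar R) -> \bar R) :=
  forall f p n : U -> \bar R, measurable_fun setT f -> measurable_fun setT p ->
    measurable_fun setT n -> (forall u, 0 <= p u) -> (forall u, 0 <= n u) ->
    I n < +oo -> I (fun u => (\1_[set u | f u != (p u - n u)%E] u)%:E) = 0 ->
    I f = I p - I n.

(** Unconditional, since +oo - +oo = -oo and a positive factor fixes both
    infinities. *)
Lemma muleB_ge0_EFin (a b : \bar R) (c : R) : 0 <= a -> 0 <= b -> (0 < c)%R ->
  (a - b) * c%:E = a * c%:E - b * c%:E.
Proof.
move=> a0 b0 c0.
have hy : +oo * c%:E = +oo by rewrite gt0_mulye ?lte_fin.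
have hNy : -oo * c%:E = -oo by rewrite gt0_mulNye ?lte_fin.
case: a b a0 b0 => [a| |] [b| |]// _ _; rewrite ?hy.
- by rewrite -EFinB -!EFinM -EFinB mulrBl.
- by rewrite (_ : a%:E - +oo = -oo)// hNy -EFinM.
- by [].
- by rewrite (_ : +oo - +oo = -oo :> \bar R)// hNy.
Qed.

(** Where the weight W vanishes the integrands vanish; where it is positive, a
    null integral of the weighted indicator forces f = p - n almost
    everywhere. *)
Lemma represents_splitting d (U : measurableType d)
    (m : {measure set U -> \bar R}) (D : set U) (J : (U -> \bar R) -> \bar R)
    (W : U -> R) :
  measurable D -> measurable_fun setT W -> (forall u, D u -> 0 <= W u)%R ->
  represents m D J -> splitting (fun f => J (fun u => f u * (W u)%:E)).
Proof.
move=> mD mW W0 [J0 Js] f p n mf mp mn p0 n0 In Ib.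
have mh (h : U -> \bar R) : measurable_fun setT h ->
    measurable_fun setT (fun u => h u * (W u)%:E).
  by move=> ?; apply: emeasurable_funM => //; exact/measurable_EFinP.
pose B := [set u | f u != (p u - n u)%E].
have mB : measurable B.
  rewrite -[B]setTI; apply: measurable_neqe => //.
  exact: emeasurable_funB.
have mb : measurable_fun setT (fun u => (\1_B u)%:E : \bar R).
  by apply/measurable_EFinP; exact: measurable_indic.
apply: Js; split; [exact: mh..| | | |].
- by move=> u Du; rewrite mule_ge0// lee_fin W0.
- by move=> u Du; rewrite mule_ge0// lee_fin W0.
- rewrite -J0//; first exact: mh.
  by move=> u Du; rewrite mule_ge0// lee_fin W0.
- have Ib0 : \int[m]_(u in D) ((\1_B u)%:E * (W u)%:E) = 0.
    rewrite -J0//; first exact: mh.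
    by move=> u Du; rewrite mule_ge0// lee_fin W0.
  have : ae_eq m D (fun u => (\1_B u)%:E * (W u)%:E) (cst 0).
    apply/ae_eq_integral_abs => //; first by apply: measurable_funTS; exact: mh.
    rewrite -[RHS]Ib0; apply: eq_integral => u /set_mem Du.
    by rewrite gee0_abs// mule_ge0// lee_fin W0.
  apply: filterS => u H Du; have := H Du.
  have := W0 _ Du; rewrite le_eqVlt => /predU1P[<- _|Wu].
    by rewrite !mule0 sube0.
  rewrite indicE; have [|/negP uB _] := boolP (u \in B).
    by rewrite mul1e => _ [] Wu0; rewrite Wu0 ltxx in Wu.
  rewrite -muleB_ge0_EFin//; congr (_ * _); apply/eqP; apply: contra_notT uB => fu.
  exact/mem_set.
Qed.

End Represents.

Section IteratedSplitting.
Context (R : realType).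
Local Notation RM := (measurableTypeR R).
Local Notation leb := (@lebesgue_measure R).
Variables (t : R).
Hypothesis t0 : (0 < t)%R.

Lemma measurable_dep_itv d (X : measurableType d) (a b : X -> RM) :
  measurable_fun setT a -> measurable_fun setT b ->
  measurable (dep_set setT (fun x => `[a x, b x]%classic : set RM)).
Proof.
move=> ma mb; rewrite (_ : dep_set _ _ =
  [set z : X * RM | (a z.1 <= z.2)%R] `&` [set z : X * RM | (z.2 <= b z.1)%R]).
  apply: measurableI.
    exact: (measurable_ler_set (measurableT_comp ma measurable_fst) measurable_snd).
  exact: (measurable_ler_set measurable_snd (measurableT_comp mb measurable_fst)).
apply/seteqP; split => z /=; rewrite /dep_set/= in_itv/=; first by move=> [_ /andP[]].
by move=> [-> ->].
Qed.

Local Ltac meas_real := 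
  do ?[exact: measurable_cst | exact: measurable_id | exact: measurable_fst
      | exact: measurable_snd
      | apply: measurable_funM | apply: measurable_funB | apply: measurable_funD
      | apply: measurable_funX
      | exact: (measurableT_comp measurable_fst measurable_fst)
      | exact: (measurableT_comp measurable_snd measurable_fst)
      | exact: (measurableT_comp measurable_fst
            (measurableT_comp measurable_fst measurable_fst))
      | exact: (measurableT_comp measurable_snd
            (measurableT_comp measurable_fst measurable_fst))].

Let E0 : RM -> set RM := fun x => `[0%R, (t - x)%R]%classic.

Let D1 : set RM := `[0%R, t]%classic.
Let mD1 : measurable D1. Proof. exact: measurable_itv. Qed.

Let rep1 := represents_integral leb mD1.

Lemma splitting_first k n : splitting (fun f : R -> \bar R =>
  \int[leb]_(y in `[0%R, t]) (f y * ((t - y) ^+ k / t ^+ n)%:E)).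
Proof.
have mW : measurable_fun setT (fun y : RM => ((t - y) ^+ k / t ^+ n)%R : R).
  by meas_real.
apply: (represents_splitting mD1 mW _ rep1) => y; rewrite /D1/= in_itv/= => /andP[y0 yt].
by rewrite divr_ge0 ?exprn_ge0 ?subr_ge0// ltW.
Qed.

Let mE0 : measurable (dep_set setT E0).
Proof. by apply: measurable_dep_itv; meas_real. Qed.

Let D2 := dep_set D1 E0.
Let mD2 : measurable D2. Proof. exact: measurable_dep_set. Qed.
Let rep2 := represents_dep leb mD1 mE0 rep1.

Lemma splitting_pair m k n : splitting (fun f : R * R -> \bar R =>
  \int[leb]_(x in `[0%R, t]) \int[leb]_(v in `[0%R, (t - x)%R])
     (f (x, v) * (x ^+ m * (t - x - v) ^+ k / t ^+ n)%:E)).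
Proof.
have mW : measurable_fun setT
    (fun z : RM * RM => (z.1 ^+ m * (t - z.1 - z.2) ^+ k / t ^+ n)%R : R).
  by meas_real.
apply: (represents_splitting mD2 mW _ rep2) => -[x v].
rewrite /D2 /D1 /E0 /dep_set /= !in_itv/= => -[/andP[x0 xt] /andP[v0 vt]].
by rewrite divr_ge0 ?mulr_ge0 ?exprn_ge0 ?subr_ge0// ltW.
Qed.

Let E3a : RM * RM -> set RM := fun z => `[0%R, (t - z.2)%R]%classic.
Let mE3a : measurable (dep_set setT E3a).
Proof. by apply: measurable_dep_itv; meas_real. Qed.
Let Ey : RM -> set RM := fun y => `[y, t]%classic.
Let mEy : measurable (dep_set setT Ey).
Proof. by apply: measurable_dep_itv; meas_real. Qed.
Let D2y := dep_set D1 Ey.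
Let mD2y : measurable D2y. Proof. exact: measurable_dep_set. Qed.
Let rep2y := represents_dep leb mD1 mEy rep1.
Let D3a := dep_set D2y E3a.
Let mD3a : measurable D3a. Proof. exact: measurable_dep_set. Qed.
Let rep3a := represents_dep leb mD2y mE3a rep2y.

Lemma splitting_first_pair l k n : splitting (fun f : R * R * R -> \bar R =>
  \int[leb]_(y in `[0%R, t]) \int[leb]_(w in `[y, t])
  \int[leb]_(v in `[0%R, (t - w)%R])
     (f (y, w, v) * ((w - y) ^+ l * (t - w - v) ^+ k / t ^+ n)%:E)).
Proof.
have mW : measurable_fun setT (fun z : RM * RM * RM =>
    ((z.1.2 - z.1.1) ^+ l * (t - z.1.2 - z.2) ^+ k / t ^+ n)%R : R).
  by meas_real.
apply: (represents_splitting mD3a mW _ rep3a) => -[[y w] v].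
rewrite /D3a /D2y /D1 /E3a /Ey /dep_set /= !in_itv/=.
move=> [[/andP[y0 yt] /andP[yw wt]] /andP[v0 vt]].
by rewrite divr_ge0 ?mulr_ge0 ?exprn_ge0 ?subr_ge0// ltW.
Qed.

Let E3b : RM * RM -> set RM := fun z => `[0%R, (t - z.1 - z.2)%R]%classic.
Let mE3b : measurable (dep_set setT E3b).
Proof. by apply: measurable_dep_itv; meas_real. Qed.
Let D3b := dep_set D2 E3b.
Let mD3b : measurable D3b. Proof. exact: measurable_dep_set. Qed.
Let rep3b := represents_dep leb mD2 mE3b rep2.

Lemma splitting_consecutive m k n : splitting (fun f : R * R * R -> \bar R =>
  \int[leb]_(y in `[0%R, t]) \int[leb]_(u in `[0%R, (t - y)%R])
  \int[leb]_(v in `[0%R, (t - y - u)%R])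
     (f (y, u, v) * (y ^+ m * (t - y - u - v) ^+ k / t ^+ n)%:E)).
Proof.
have mW : measurable_fun setT (fun z : RM * RM * RM =>
    (z.1.1 ^+ m * (t - z.1.1 - z.1.2 - z.2) ^+ k / t ^+ n)%R : R).
  by meas_real.
apply: (represents_splitting mD3b mW _ rep3b) => -[[y u] v].
rewrite /D3b /D2 /D1 /E3b /E0 /dep_set /= !in_itv/=.
move=> [[/andP[y0 yt] /andP[u0 ut]] /andP[v0 vt]].
by rewrite divr_ge0 ?mulr_ge0 ?exprn_ge0 ?subr_ge0// ltW.
Qed.

Let E3 : RM * RM -> set RM := fun z => `[(z.1 + z.2)%R, t]%classic.
Let mE3 : measurable (dep_set setT E3).
Proof. by apply: measurable_dep_itv; meas_real. Qed.
Let D3 := dep_set D2 E3.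
Let mD3 : measurable D3. Proof. exact: measurable_dep_set. Qed.
Let rep3 := represents_dep leb mD2 mE3 rep2.
Let E4 : RM * RM * RM -> set RM := fun z => `[0%R, (t - z.2)%R]%classic.
Let mE4 : measurable (dep_set setT E4).
Proof. by apply: measurable_dep_itv; meas_real. Qed.
Let D4 := dep_set D3 E4.
Let mD4 : measurable D4. Proof. exact: measurable_dep_set. Qed.
Let rep4 := represents_dep leb mD3 mE4 rep3.

Lemma splitting_two_pairs m l k n : splitting (fun f : R * R * R * R -> \bar R =>
  \int[leb]_(x in `[0%R, t]) \int[leb]_(u in `[0%R, (t - x)%R])
  \int[leb]_(w in `[(x + u)%R, t]) \int[leb]_(v in `[0%R, (t - w)%R])
     (f (x, u, w, v) *
       (x ^+ m * (w - x - u) ^+ l * (t - w - v) ^+ k / t ^+ n)%:E)).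
Proof.
have mW : measurable_fun setT (fun z : RM * RM * RM * RM =>
    (z.1.1.1 ^+ m * (z.1.2 - z.1.1.1 - z.1.1.2) ^+ l *
      (t - z.1.2 - z.2) ^+ k / t ^+ n)%R : R).
  by meas_real.
apply: (represents_splitting mD4 mW _ rep4) => -[[[x u] w] v].
rewrite /D4 /D3 /D2 /D1 /E4 /E3 /E0 /dep_set /= !in_itv/=.
move=> [[[/andP[x0 xt] /andP[u0 ut]] /andP[xuw wt]] /andP[v0 vt]].
have xuw' : (0 <= w - x - u)%R by rewrite -addrA -opprD subr_ge0.
apply: divr_ge0; last by rewrite exprn_ge0// ltW.
by apply: mulr_ge0; [apply: mulr_ge0|]; rewrite exprn_ge0// subr_ge0.
Qed.

End IteratedSplitting.

(** * Regression functions on events of the claim process *)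

Section KernelIntegral.
Context d (T : measurableType d) (R : realType).
Context d' (U : measurableType d').
Variables (m : {measure set T -> \bar R}) (E : set T) (Y : T -> U)
  (k : T -> {measure set U -> \bar R}).
Hypotheses (mE : measurable E) (mY : measurable_fun setT Y)
  (mk : forall A, measurable A -> measurable_fun setT (k ^~ A))
  (mEk : forall A, measurable A -> m (E `&` Y @^-1` A) = \int[m]_(w in E) k w A).

Import HBNNSimple.

Let kernel_integral_nnsfun (g : {nnsfun U >-> R}) :
  \int[m]_(w in E) (g (Y w))%:E = \int[m]_(w in E) \int[k w]_y (g y)%:E.
Proof.
have mg r : measurable (g @^-1` [set r]) by [].
have mgE : measurable_fun setT (EFin \o g) by exact/measurable_EFinP.
have g0 y : 0 <= (EFin \o g) y by rewrite lee_fin.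
rewrite -(ge0_integral_mrestr m mE); last 2 first.
- exact: (measurableT_comp mgE mY).
- by move=> w; rewrite lee_fin.
rewrite -[LHS](@ge0_integral_pushforward _ _ _ _ _ Y mY (mrestr m mE) setT (EFin \o g))//.
pose Q := measure_function_pushforward__canonical__measure_function_Measure
  (mrestr m mE) mY.
rewrite -[LHS]/(\int[Q]_y (g y)%:E) integralT_nnsfun sintegralE.
under [RHS]eq_integral do rewrite integralT_nnsfun sintegralE.
rewrite ge0_integral_fsum//; last 2 first.
- by move=> r; apply: measurable_funTS; apply: emeasurable_funM => //; exact: mk.
- by move=> r w _; have := mulemu_ge0 (fun r => g @^-1` [set r]);
    apply; exact: preimage_nnfun0.
apply: eq_fsbigr => r _.
have [r0|r0] := leP 0%R r; last first.
  rewrite integral0_eq; first by rewrite preimage_nnfun0// measure0 mule0.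
  by move=> w _; rewrite preimage_nnfun0// measure0 mule0.
rewrite ge0_integralZl_EFin//; last by apply: measurable_funTS; exact: mk.
by rewrite -mEk// setIC.
Qed.

(** The identity known for sets extends to simple functions by linearity and to
    nonnegative functions by monotone convergence. *)
Lemma ge0_kernel_integral (f : U -> \bar R) : measurable_fun setT f ->
  (forall y, 0 <= f y) ->
  \int[m]_(w in E) f (Y w) = \int[m]_(w in E) \int[k w]_y f y.
Proof.
move=> mf f0; pose g := nnsfun_approx measurableT mf.
have mg n : measurable_fun setT (fun y => (g n y)%:E) by exact/measurable_EFinP.
have gf y : limn (fun n => (g n y)%:E) = f y.
  by apply/cvg_lim => //; exact: cvg_nnsfun_approx.
have gnd y : nondecreasing_seq (fun n => (g n y)%:E).
  by move=> a b ab; rewrite lee_fin; exact/lefP/nd_nnsfun_approx.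
transitivity (limn (fun n => \int[m]_(w in E) (g n (Y w))%:E)).
  rewrite -monotone_convergence//.
  - by apply: eq_integral => w _; rewrite gf.
  - by move=> n; apply: measurable_funTS; exact: (measurableT_comp (mg n) mY).
  - by move=> n w _; rewrite lee_fin.
under eq_fun do rewrite kernel_integral_nnsfun.
rewrite -monotone_convergence//.
- apply: eq_integral => w _; rewrite -monotone_convergence//.
    by apply: eq_integral => y _; rewrite gf.
  by move=> n y _; rewrite lee_fin.
- move=> n; apply: measurable_funTS; apply: measurable_fun_integral_kernel => //.
  by move=> y; rewrite lee_fin.
- by move=> n w _; apply: integral_ge0 => y _; rewrite lee_fin.
- move=> w _ a b ab; apply: ge0_le_integral => //.
  + by move=> y _; rewrite lee_fin.
  + by move=> y _; exact: gnd.
Qed.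

End KernelIntegral.

Section IntegralUnique.
Context d (T : measurableType d) (R : realType).
Variable m : {measure set T -> \bar R}.
Hypothesis moo : m setT < +oo.

Let le_level (f g : T -> \bar R) : measurable_fun setT f -> measurable_fun setT g ->
  (forall u, 0 <= f u) -> (forall u, 0 <= g u) ->
  (forall B, measurable B -> \int[m]_(u in B) f u = \int[m]_(u in B) g u) ->
  forall M : nat, ae_eq m [set u | f u <= M%:R%:E] f g.
Proof.
move=> mf mg f0 g0 fg M.
have mB : measurable [set u | f u <= M%:R%:E].
  by rewrite -[X in measurable X]setTI; exact: emeasurable_fun_infty_c.
apply: integral_ae_eq => //; last 2 first.
- exact: measurable_funTS.
- by move=> B _ mB'; exact: fg.
apply/integrableP; split; first exact: measurable_funTS.
apply: (@le_lt_trans _ _ (\int[m]_(u in [set u | f u <= M%:R%:E]) (cst M%:R%:E) u)).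
  apply: ge0_le_integral => //.
  - by apply: measurable_funTS; exact: measurableT_comp.
  - by move=> u /= fM; rewrite gee0_abs.
rewrite integral_cst//= lte_mul_pinfty ?lee_fin//.
by apply: le_lt_trans moo; rewrite le_measure ?inE.
Qed.

(** Integrals over subsets of the level sets f <= M are finite, which gives
    equality there, and likewise for g; outside all these sets both are
    +oo. *)
Lemma ge0_integral_unique (f g : T -> \bar R) :
  measurable_fun setT f -> measurable_fun setT g ->
  (forall u, 0 <= f u) -> (forall u, 0 <= g u) ->
  (forall B, measurable B -> \int[m]_(u in B) f u = \int[m]_(u in B) g u) ->
  ae_eq m setT f g.
Proof.
move=> mf mg f0 g0 fg.
have lf : {ae m, forall u, forall M : nat, f u <= M%:R%:E -> f u = g u}.
  by apply/ae_foralln => M; exact: le_level.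
have lg : {ae m, forall u, forall M : nat, g u <= M%:R%:E -> g u = f u}.
  apply/ae_foralln => M; apply: le_level => // B mB; exact/esym/fg.
apply: filterS2 lf lg => u lf lg _.
have bound (x : \bar R) : 0 <= x -> x < +oo -> exists M : nat, x <= M%:R%:E.
  case: x => // x; rewrite lee_fin => x0 _.
  by exists (Num.bound x); rewrite lee_fin ltW// archi_boundP.
have [fy|] := ltP (f u) +oo; first by have [M /lf] := bound _ (f0 u) fy.
rewrite leye_eq => /eqP fy.
have [gy|] := ltP (g u) +oo; first by have [M /lg] := bound _ (g0 u) gy.
by rewrite leye_eq => /eqP ->.
Qed.

End IntegralUnique.

Section Conditioning.
Context (d : measure_display) (Omega : measurableType d) (R : realType).
Variables (P : probability Omega R) (T : nat -> Omega -> \bar R)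
  (N : R -> Omega -> nat).
Hypothesis HT : claim_arrivals T N.

(** The generators of sigma_process, named so that the events of the claim
    process form a measurable space on Omega. *)
Definition count_events : set (set Omega) :=
  [set F | exists s n, (0 <= s)%R /\ F = [set w | N s w = n]].

Local Notation OmegaN := (g_sigma_algebraType count_events).

Lemma sigma_process_measurable F : sigma_process N F -> measurable F.
Proof.
move: F; apply: smallest_sub; first exact: sigma_algebra_measurable.
by move=> _ [s [n [s0 ->]]]; exact: (measurable_count HT).
Qed.

Lemma sigma_process_count t n : (0 <= t)%R ->
  sigma_process N [set w | N t w = n].
Proof. by move=> t0; apply: sub_sigma_algebra; exists t, n. Qed.

(** T i <= s means that at least i claims have arrived by s. *)
Lemma arrival_sigma_process i :
  measurable_fun [set: OmegaN] (T i : OmegaN -> \bar R).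
Proof.
apply: (measurability _ (ErealGenOInfty.measurableE R)) => _ [_ [s ->] <-].
rewrite setTI (_ : _ @^-1` _ = ~` [set w | T i w <= s%:E]); last first.
  by apply/seteqP; split => w /=; rewrite in_itv/= andbT ltNge => /negP.
apply: (@measurableC _ OmegaN); have [s0|s0] := leP 0%R s.
  rewrite (_ : [set w | _] = \bigcup_(n in [set n | (i <= n)%N]) [set w | N s w = n]).
    apply: (@bigcup_measurable _ OmegaN) => n _.
    exact: sigma_process_count.
  apply/seteqP; split => w /=; rewrite (arrival_countE HT)// => H.
    by exists (N s w).
  by case: H => n /= ni ->.
rewrite (_ : [set w | _] = set0); first exact: (@measurable0 _ OmegaN).
rewrite -subset0 => w /=; apply/negP; rewrite -ltNge.
by apply: lt_le_trans (arrival_ge0 HT i w); rewrite lte_fin.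
Qed.

Lemma fine_arrival_sigma_process i :
  measurable_fun [set: OmegaN] (fun w : OmegaN => fine (T i w)).
Proof.
exact: (measurableT_comp (@fine_measurable R setT measurableT) (arrival_sigma_process i)).
Qed.

Lemma interclaim_sigma_process i :
  measurable_fun [set: OmegaN] (fun w : OmegaN => fine (interclaim T i w)).
Proof.
apply: (measurableT_comp (@fine_measurable R setT measurableT)).
by apply: emeasurable_funB; exact: arrival_sigma_process.
Qed.

Lemma sigma_process_finite i : sigma_process N [set w | T i w < +oo].
Proof.
rewrite -[X in sigma_process N X]setTI.
have := @arrival_sigma_process i measurableT [set x | x < +oo].
apply; rewrite (_ : [set x | _] = ~` [set +oo]); first exact: measurableC.
apply/seteqP; split => x /=; first by move=> xy xE; rewrite xE ltxx in xy.
by rewrite ltey => /eqP.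
Qed.

Lemma sigma_process_measurable_fun d' (U : measurableType d') (Z : Omega -> U) :
  measurable_fun [set: OmegaN] (Z : OmegaN -> U) -> measurable_fun setT Z.
Proof. by move=> mZ _ B mB; apply: sigma_process_measurable; exact: (mZ). Qed.

(** The regression function g is only tied to Y on the events of Z'; the
    assumption on the conditional law given the process extends this to every
    event F of the process. The conditional law is a kernel in Z, while Z' lists
    the times without redundancy; phi recovers Z from Z' on D, for instance by
    T 0 = 0 or by T i = T (i - 1) + V i. *)
Lemma ge0_regression_integral dU dU' (U : measurableType dU)
    (U' : measurableType dU') (Y : Omega -> R) (D : set Omega)
    (Z : Omega -> U) (Z' : Omega -> U') (phi : U' -> U) (f : R -> \bar R)
    (g : U' -> \bar R) :
  measurable_fun setT Y -> sigma_process N D ->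
  measurable_fun [set: OmegaN] (Z' : OmegaN -> U') ->
  measurable_fun setT phi -> (forall w, D w -> Z w = phi (Z' w)) ->
  depends_only_via P N Y D Z ->
  measurable_fun setT f -> (forall y, 0 <= f y) ->
  nonneg_regression P (fun w => f (Y w)) D Z' g ->
  forall F, sigma_process N F ->
  \int[P]_(w in F `&` D) f (Y w) = \int[P]_(w in F `&` D) g (Z' w).
Proof.
move=> mY sD mZN mphi ZE [k kP] mf f0 [mg g0 gP] F sF.
have mZ := sigma_process_measurable_fun mZN.
have mD := sigma_process_measurable sD.
(* The regression function given the whole process, read off the kernel. *)
pose h (u : U') := \int[k (phi u)]_y f y.
have mh : measurable_fun setT h.
  apply: (@measurable_fun_integral_kernel _ _ _ _ _ (fun u => k (phi u))) => //.
  by move=> A mA; exact: (measurableT_comp (measurable_kernel k A mA) mphi).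
have h0 u : 0 <= h u by exact: integral_ge0.
have fh F' : sigma_process N F' ->
    \int[P]_(w in F' `&` D) f (Y w) = \int[P]_(w in F' `&` D) h (Z' w).
  move=> sF'; have mF' := sigma_process_measurable sF'.
  rewrite /h; apply: (@ge0_kernel_integral _ _ _ _ (measurableTypeR R) P
    (F' `&` D) Y (fun w => k (phi (Z' w)))) => //.
  - exact: measurableI.
  - move=> A mA.
    exact: (measurableT_comp (measurableT_comp (measurable_kernel k A mA) mphi) mZ).
  - move=> A mA; rewrite [LHS](kP F' A sF' mA).
    by apply: eq_integral => w /set_mem [_ Dw]; rewrite ZE.
pose nu := measure_function_pushforward__canonical__measure_function_Measure
  (mrestr P mD) mZ.
have nuE B : nu B = P (Z' @^-1` B `&` D) by [].
have nuint (q : U' -> \bar R) B : measurable B -> measurable_fun setT q ->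
    (forall u, 0 <= q u) ->
    \int[nu]_(u in B) q u = \int[P]_(w in D `&` Z' @^-1` B) q (Z' w).
  move=> mB mq q0.
  rewrite ge0_integral_pushforward//; last exact: measurable_funTS.
  rewrite integral_mkcond ge0_integral_mrestr; last 2 first.
  - apply: measurable_patch; last exact: measurableT_comp.
    by rewrite -[X in measurable X]setTI; exact: (mZ).
  - by move=> w; apply: erestrict_ge0 => w1 _; exact: q0.
  by rewrite -integral_mkcondr.
(* h and g have the same integrals over the events of Z'. *)
have hg : ae_eq nu setT h g.
  apply: ge0_integral_unique => //.
    rewrite nuE (le_lt_trans (probability_le1 P _)) ?ltry//.
    by rewrite preimage_setT setTI.
  move=> B mB; rewrite !nuint// -gP// setIC -fh//.
  by rewrite -[X in sigma_process N X]setTI; exact: (mZN).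
rewrite fh//; apply: ge0_ae_eq_integral.
- exact: measurableI (sigma_process_measurable sF) mD.
- by apply: measurable_funTS; exact: measurableT_comp.
- by apply: measurable_funTS; exact: measurableT_comp.
- by move=> w _.
- by move=> w _.
case: hg => B [mB B0 subB].
exists (Z' @^-1` B `&` D); split => //.
  apply: measurableI => //.
  by rewrite -[X in measurable X]setTI; exact: (mZ).
move=> w /= H; split.
  by apply: subB => /= K; apply: H => _; exact: K.
by apply: contrapT => Dw; apply: H => -[].
Qed.

End Conditioning.

(** * The structure distribution *)

Section MixedPoissonWeight.
Context (d : measure_display) (Omega : measurableType d) (R : realType).
Variables (P : probability Omega R) (L : cumulativeBounded (0%R : R) (1%R : R))
  (Lambda : {RV P >-> R}).
Hypotheses (Lambda_ge0 : forall w, (0 <= Lambda w)%R)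
  (LambdaL : forall l : R, cdf Lambda l = (L l)%:E).
Local Notation RM := (measurableTypeR R).

(** Both measures give L b - L a to the interval ]a, b]. *)
Lemma structure_law (A : set RM) : measurable A ->
  lebesgue_stieltjes_measure L A = pushforward P Lambda A.
Proof.
have mL : measurable_fun [set: Omega] (Lambda : Omega -> RM).
  by have mL := @measurable_funPT _ _ _ _ Lambda; exact: mL.
apply: (@lebesgue_stieltjes_measure_unique _ L
  (measure_function_pushforward__canonical__measure_function_Measure P mL))
  => [I [[a b]]/= _ <-].
rewrite /lebesgue_stieltjes_measure /measure_extension/=.
rewrite measurable_mu_extE/=; last exact: is_ocitv.
have [ab | ba] := leP a b; last first.
  rewrite set_itv_ge ?wlength0 /pushforward ?preimage_set0 ?measure0//.
  by rewrite bnd_simp -leNgt ltW.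
rewrite wlength_itv_bnd// EFinB -!LambdaL /cdf /distribution.
have : `]a, b]%classic = `]-oo, b] `\` `]-oo, a] => [|->].
  by rewrite -[RHS]setCK setCD setCitvl setUC -[LHS]setCK setCitv.
have mpre (B : set RM) : measurable B -> measurable (Lambda @^-1` B).
  by move=> mB; rewrite -[X in measurable X]setTI; exact: mL.
rewrite /pushforward setDE preimage_setI preimage_setC -setDE measureD;
  [|exact: (mpre _ (measurable_itv _))..|].
  by rewrite setIidr// => w /=; rewrite !in_itv/= => /le_trans; apply.
by rewrite (le_lt_trans (probability_le1 P _)) ?ltry//; exact: (mpre _ (measurable_itv _)).
Qed.

Lemma mixed_poisson_weightE t n : (0 < t)%R ->
  mixed_poisson_weight L t n =
  \int[P]_w (poisson_weight (Lambda w * t) n)%:E.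
Proof.
move=> t0; have mL : measurable_fun [set: Omega] (Lambda : Omega -> RM).
  by have mL := @measurable_funPT _ _ _ _ Lambda; exact: mL.
have mpw : measurable_fun [set: RM] (fun l : RM => (poisson_weight (l * t)%R n)%:E).
  apply/measurable_EFinP; rewrite /poisson_weight; apply: measurable_funM.
    apply: measurable_funM => //; apply: measurable_funX.
    exact: measurable_funM.
  apply: measurableT_comp => //; apply: measurableT_comp => //.
  exact: measurable_funM.
rewrite /mixed_poisson_weight.
rewrite (eq_measure_integral
  (measure_function_pushforward__canonical__measure_function_Measure P mL));
  last by move=> A mA _; exact: structure_law.
rewrite [LHS](@ge0_integral_pushforward _ _ _ RM _ Lambda mL)//.
- rewrite (_ : _ @^-1` _ = setT)//; apply/seteqP; split => // w _ /=.
  by rewrite in_itv/= Lambda_ge0.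
- exact: measurable_funTS.
- move=> l /set_mem /=; rewrite in_itv/= andbT => l0.
  by rewrite lee_fin poisson_weight_ge0// mulr_ge0// ltW.
Qed.

End MixedPoissonWeight.

(** * Expectations on the event of n claims *)

Section RegressionTerm.
Context (d : measure_display) (Omega : measurableType d) (R : realType).
Variables (P : probability Omega R) (Lambda : {RV P >-> R})
  (T : nat -> Omega -> \bar R) (N : R -> Omega -> nat).
Hypotheses (HT : claim_arrivals T N) (HN : mixed_poisson Lambda N)
  (Lambda_ge0 : forall w, (0 <= Lambda w)%R).
Variables (t : R) (n : nat).
Hypothesis t0 : (0 < t)%R.
Local Notation leb := (@lebesgue_measure R).

Let E := [set w | N t w = n].

Lemma arrivals_integral (f : seq R -> \bar R) : seq_measurable f ->
  (forall s, 0 <= f s) ->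
  \int[P]_(w in E) f (arrivals T n w) =
  P E * ((n`!%:R / t ^+ n)%:E * simplex_integral n t 0%R f).
Proof.
move=> mf f0.
have c0 : (0 <= n`!%:R / t ^+ n * fine (P E))%R.
  by rewrite mulr_ge0 ?fine_ge0// divr_ge0// exprn_ge0// ltW.
have mE : measurable E by apply: (measurable_count HT); exact: ltW.
rewrite (@ge0_integral_restricted_law _ _ _ P _ _ (arrivals T n) E
  (tuple_measure leb n) (simplex n t 0%R) (NngNum c0) (fun v => f v))//.
- by rewrite muleA [P E * _]muleC /= EFinM fineK// fin_num_measure.
- exact: measurable_simplex.
- exact: (measurable_arrivals HT).
- move=> A mA; rewrite [LHS](arrivals_law HT HN Lambda_ge0 t0 mA).
  change ((n`!%:R / t ^+ n)%:E * P E * tuple_measure leb n (A `&` simplex n t 0%R) =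
    (n`!%:R / t ^+ n * fine (P E))%:E * tuple_measure leb n (A `&` simplex n t 0%R)).
  by rewrite [in RHS]EFinM fineK// fin_num_measure.
- exact: (mf n).
Qed.

(** The common scheme of all the terms: psi is the square for X_i^2 and the
    identity for the products, Z' is the list of times in the regression, and
    coef and I are the coefficient and the iterated integral that the law of the
    arrival times assigns to Z'. *)
Lemma regression_term dU dU' (U : measurableType dU) (U' : measurableType dU')
    (X0 : Omega -> R) (psi : R -> R) (D : set Omega)
    (Z : Omega -> U) (Z' : Omega -> U') (phi : U' -> U) (g : U' -> \bar R)
    (coef : R) (I : (U' -> \bar R) -> \bar R) :
  measurable_fun setT X0 -> measurable_fun setT psi ->
  sigma_process N D -> E `<=` D ->
  measurable_fun [set: g_sigma_algebraType (count_events N)]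
    (Z' : g_sigma_algebraType (count_events N) -> U') ->
  measurable_fun setT phi -> (forall w, D w -> Z w = phi (Z' w)) ->
  depends_only_via P N X0 D Z ->
  regression P (fun w => psi (X0 w)) D Z' g ->
  (forall p, measurable_fun setT p -> (forall u, 0 <= p u) ->
     \int[P]_(w in E) p (Z' w) = P E * (coef%:E * I p)) ->
  splitting I -> (0 < coef)%R ->
  \int[P]_(w in E) (EFin \o (fun w => psi (X0 w)))^\- w < +oo ->
  \int[P]_(w in E) (psi (X0 w))%:E = P E * (coef%:E * I g).
Proof.
move=> mX mpsi sD ED mZ mphi ZE dep [mg [gp [gn [regp regn gE]]]] marg split c0 negoo.
have mE : measurable E by apply: (measurable_count HT); exact: ltW.
have sE : sigma_process N E by apply: sigma_process_count; exact: ltW.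
have mD := sigma_process_measurable HT sD.
have mY : measurable_fun setT (fun w => psi (X0 w)) by exact: measurableT_comp.
have PEfin : P E \is a fin_num by exact: fin_num_measure.
have [PE0|PE0] := eqVneq (P E) 0.
  rewrite PE0 mul0e; apply: null_set_integral => //.
  by apply/measurable_EFinP; exact: measurable_funTS.
pose fp (y : R) := maxe (psi y)%:E 0; pose fn (y : R) := maxe (- (psi y)%:E) 0.
have posE : (EFin \o (fun w => psi (X0 w)))^\+ = (fun w => fp (X0 w)).
  by apply/funext => w; rewrite funeposE.
have negE : (EFin \o (fun w => psi (X0 w)))^\- = (fun w => fn (X0 w)).
  by apply/funext => w; rewrite funenegE.
have mpsiE : measurable_fun setT (EFin \o psi) by exact/measurable_EFinP.
have mfp : measurable_fun setT fp.
  by apply: measurable_maxe => //; exact: measurable_cst.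
have mfn : measurable_fun setT fn.
  by apply: measurable_maxe; [exact: measurableT_comp|exact: measurable_cst].
have fp0 y : 0 <= fp y by rewrite le_max lexx orbT.
have fn0 y : 0 <= fn y by rewrite le_max lexx orbT.
rewrite posE in regp; rewrite negE in regn.
have EDE : E `&` D = E by exact/setIidPl.
have reg f q (mf : measurable_fun setT f) (f0 : forall y, 0 <= f y)
    (r : nonneg_regression P (fun w => f (X0 w)) D Z' q) :
    \int[P]_(w in E) f (X0 w) = \int[P]_(w in E) q (Z' w).
  by have := ge0_regression_integral HT mX sD mZ mphi ZE dep mf f0 r sE; rewrite EDE.
have [mgp gp0 _] := regp; have [mgn gn0 _] := regn.
have Ep := reg _ _ mfp fp0 regp; have En := reg _ _ mfn fn0 regn.
pose e := (fine (P E) * coef)%R.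
have e0 : (0 < e)%R.
  rewrite mulr_gt0// fine_gt0// lt_neqAle eq_sym PE0 measure_ge0/=.
  by rewrite ltey_eq PEfin.
have margE p : measurable_fun setT p -> (forall u, 0 <= p u) ->
    \int[P]_(w in E) p (Z' w) = e%:E * I p.
  by move=> mp p0; rewrite marg// muleA /e EFinM fineK.
have I0 p : measurable_fun setT p -> (forall u, 0 <= p u) -> 0 <= I p.
  move=> mp p0; rewrite -(@pmule_rge0 _ e%:E) ?lte_fin//.
  by rewrite -margE//; exact: integral_ge0.
have Ign : I gn < +oo.
  rewrite ltey; apply/eqP => Igy; move: negoo; rewrite negE En margE// Igy.
  by rewrite gt0_muley ?lte_fin// ltxx.
pose B := [set u | g u != gp u - gn u].
have mB : measurable B.
  rewrite -[B]setTI; apply: measurable_neqe => //.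
  exact: emeasurable_funB.
(* On E the law of Z' is a positive multiple of I, and B is null for it. *)
have Ib : I (fun u => (\1_B u)%:E) = 0.
  have mb : measurable_fun setT (fun u => (\1_B u)%:E : \bar R).
    by apply/measurable_EFinP; exact: measurable_indic.
  have : e%:E * I (fun u => (\1_B u)%:E) = 0.
    rewrite -margE//.
    rewrite -[RHS](integral0 P E); apply: ge0_ae_eq_integral => //.
    - by apply: measurable_funTS; apply: (measurableT_comp mb);
        exact: (sigma_process_measurable_fun HT mZ).
    - apply: filterS gE => w gw Ew; rewrite indicE memNset//= /B /=.
      by apply/negP; rewrite negbK; apply/eqP/gw; exact: ED.
  by move=> /eqP; rewrite mule_eq0 eqe gt_eqF//= => /eqP.
rewrite (split g gp gn)// integralE posE negE Ep En !margE//.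
rewrite [RHS]muleA -(fineK PEfin) -EFinM -/e.
rewrite [RHS]muleC muleB_ge0_EFin ?I0//.
by rewrite ![_ * e%:E]muleC.
Qed.

End RegressionTerm.

Section Terms.
Context (d : measure_display) (Omega : measurableType d) (R : realType).
Variables (P : probability Omega R) (Lambda : {RV P >-> R})
  (T : nat -> Omega -> \bar R) (N : R -> Omega -> nat) (X : nat -> {RV P >-> R}).
Hypotheses (HT : claim_arrivals T N) (HN : mixed_poisson Lambda N)
  (Lambda_ge0 : forall w, (0 <= Lambda w)%R).
Variables (t : R) (n : nat).
Hypothesis t0 : (0 < t)%R.
Local Notation leb := (@lebesgue_measure R).

Let E := [set w | N t w = n].

Lemma arrival_lty i w : E w -> (i <= n)%N -> T i w < +oo.
Proof.
move=> Ew ni; have : T i w <= t%:E by rewrite (arrival_countE HT) ?Ew// ltW.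
by move=> /le_lt_trans; apply; rewrite ltry.
Qed.

Lemma arrival_fine i w : T i w < +oo -> T i w = (fine (T i w))%:E.
Proof. by move=> Ti; rewrite fineK// (arrival_fin_num HT). Qed.

Lemma fine_interclaim i w : T i.+1 w < +oo ->
  fine (interclaim T i.+1 w) = (fine (T i.+1 w) - fine (T i w))%R.
Proof.
move=> TS; have Ti : T i w < +oo by apply: le_lt_trans TS; exact: (arrival_leS HT).
by rewrite /interclaim /= (arrival_fine TS) (arrival_fine Ti).
Qed.

Lemma nth_arrival i w : (i < n)%N -> nth 0%R (arrivals T n w) i = fine (T i.+1 w).
Proof. by move=> ni; rewrite -(nth_arrivals HT w ni). Qed.

Let aint (f : seq R -> \bar R) : seq_measurable f -> (forall s, 0 <= f s) ->
  \int[P]_(w in E) f (arrivals T n w) =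
  P E * ((n`!%:R / t ^+ n)%:E * simplex_integral n t 0%R f).
Proof. exact: (arrivals_integral HT HN Lambda_ge0 n t0). Qed.

(** The marginals of the uniform law, read off the arrival times: on N t = n the
    variables T i and V i are coordinates and differences of coordinates, the
    coordinate of index k being T (k + 1). *)
Lemma marginal_first (p : R -> \bar R) : (0 < n)%N ->
  measurable_fun setT p -> (forall u, 0 <= p u) ->
  \int[P]_(w in E) p (fine (T 1%N w)) = P E * (n%:R%:E *
    \int[leb]_(y in `[0%R, t]) (p y * ((t - y) ^+ n.-1 / t ^+ n)%:E)).
Proof.
move=> n0 mp p0.
pose f (s : seq R) := p (nth (0%R : R) s 0%N).
transitivity (\int[P]_(w in E) f (arrivals T n w)).
  by apply: eq_integral => w _; rewrite /f nth_arrival.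
rewrite (aint (f := f)); [|by seq_meas|by nonneg]; congr (_ * _).
by rewrite -(prednK n0) simplex_marginal_first.
Qed.

Lemma marginal_pair i (p : R * R -> \bar R) : (2 <= i <= n)%N ->
  measurable_fun setT p -> (forall u, 0 <= p u) ->
  \int[P]_(w in E) p (fine (T i.-1 w), fine (interclaim T i w)) =
  P E * ((n`!%:R / ((i - 2)`! * (n - i)`!)%N%:R)%:E *
      \int[leb]_(x in `[0%R, t]) \int[leb]_(v in `[0%R, (t - x)%R])
        (p (x, v) * (x ^+ (i - 2) * (t - x - v) ^+ (n - i) / t ^+ n)%:E)).
Proof.
case: i => [|[|m]]// /andP[_ mn] mp p0.
pose f (s : seq R) := p (nth (0%R : R) s m, nth 0 s m.+1 - nth 0 s m)%R.
transitivity (\int[P]_(w in E) f (arrivals T n w)).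
  apply: eq_integral => w /set_mem Ew; rewrite /f.
  by rewrite !nth_arrival ?(ltnW mn)// fine_interclaim// arrival_lty.
rewrite (aint (f := f)); [|by seq_meas|by nonneg]; congr (_ * _).
have [k nE] : exists k, n = (m.+1 + k.+1)%N by exists (n - m.+2)%N; lia.
have -> : (n - m.+2)%N = k by lia.
have -> : (m.+2 - 2)%N = m by lia.
by rewrite nE; exact: simplex_marginal_pair.
Qed.

Lemma marginal_first_pair j (p : R * R * R -> \bar R) : (3 <= j <= n)%N ->
  measurable_fun setT p -> (forall u, 0 <= p u) ->
  \int[P]_(w in E) p (fine (T 1%N w), fine (T j.-1 w), fine (interclaim T j w)) =
  P E * ((n`!%:R / ((j - 3)`! * (n - j)`!)%N%:R)%:E *
      \int[leb]_(y in `[0%R, t]) \int[leb]_(w in `[y, t])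
      \int[leb]_(v in `[0%R, (t - w)%R])
        (p (y, w, v) *
         ((w - y) ^+ (j - 3) * (t - w - v) ^+ (n - j) / t ^+ n)%:E)).
Proof.
case: j => [|[|[|l]]]// /andP[_ ln] mp p0.
pose f (s : seq R) := p (nth (0%R : R) s 0%N, nth 0 s l.+1, nth 0 s l.+2 - nth 0 s l.+1)%R.
transitivity (\int[P]_(w in E) f (arrivals T n w)).
  apply: eq_integral => w /set_mem Ew; rewrite /f.
  rewrite !nth_arrival ?(ltnW ln) ?(leq_ltn_trans _ ln)// fine_interclaim//.
  exact: arrival_lty.
rewrite (aint (f := f)); [|by seq_meas|by nonneg]; congr (_ * _).
have [k nE] : exists k, n = (l.+1 + k.+1).+1%N by exists (n - l.+3)%N; lia.
have -> : (n - l.+3)%N = k by lia.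
have -> : (l.+3 - 3)%N = l by lia.
by rewrite nE; exact: simplex_marginal_first_pair.
Qed.

Lemma marginal_consecutive i (p : R * R * R -> \bar R) : (2 <= i < n)%N ->
  measurable_fun setT p -> (forall u, 0 <= p u) ->
  \int[P]_(w in E) p (fine (T i.-1 w), fine (interclaim T i w),
                      fine (interclaim T i.+1 w)) =
  P E * ((n`!%:R / ((i - 2)`! * (n - i - 1)`!)%N%:R)%:E *
      \int[leb]_(y in `[0%R, t]) \int[leb]_(u in `[0%R, (t - y)%R])
      \int[leb]_(v in `[0%R, (t - y - u)%R])
        (p (y, u, v) *
         (y ^+ (i - 2) * (t - y - u - v) ^+ (n - i - 1) / t ^+ n)%:E)).
Proof.
case: i => [|[|m]]// /andP[_ mn] mp p0.
pose f (s : seq R) := p (nth (0%R : R) s m, nth 0 s m.+1 - nth 0 s m,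
     nth 0 s m.+2 - nth 0 s m.+1)%R.
transitivity (\int[P]_(w in E) f (arrivals T n w)).
  apply: eq_integral => w /set_mem Ew; rewrite /f.
  have mn1 := ltnW mn; have mn2 := ltnW mn1.
  by rewrite !nth_arrival// !fine_interclaim// arrival_lty.
rewrite (aint (f := f)); [|by seq_meas|by nonneg]; congr (_ * _).
have [k nE] : exists k, n = (m.+1 + k.+2)%N by exists (n - m.+2 - 1)%N; lia.
have -> : (n - m.+2 - 1)%N = k by lia.
have -> : (m.+2 - 2)%N = m by lia.
by rewrite nE; exact: simplex_marginal_consecutive.
Qed.

Lemma marginal_two_pairs i j (p : R * R * R * R -> \bar R) :
  (2 <= i)%N -> (i.+2 <= j <= n)%N ->
  measurable_fun setT p -> (forall u, 0 <= p u) ->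
  \int[P]_(w in E) p (fine (T i.-1 w), fine (interclaim T i w),
                      fine (T j.-1 w), fine (interclaim T j w)) =
  P E * ((n`!%:R / ((i - 2)`! * (j - i - 2)`! * (n - j)`!)%N%:R)%:E *
      \int[leb]_(x in `[0%R, t]) \int[leb]_(u in `[0%R, (t - x)%R])
      \int[leb]_(w in `[(x + u)%R, t]) \int[leb]_(v in `[0%R, (t - w)%R])
        (p (x, u, w, v) *
         (x ^+ (i - 2) * (w - x - u) ^+ (j - i - 2) * (t - w - v) ^+ (n - j)
          / t ^+ n)%:E)).
Proof.
case: i => [|[|m]]// _ /andP[mj jn] mp p0.
have [l jE] : exists l, j = (m + l.+4)%N by exists (j - m - 4)%N; lia.
pose f (s : seq R) := p (nth (0%R : R) s m, nth 0 s m.+1 - nth 0 s m,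
     nth 0 s (m + l.+2)%N, nth 0 s (m + l.+3)%N - nth 0 s (m + l.+2)%N)%R.
transitivity (\int[P]_(w in E) f (arrivals T n w)).
  apply: eq_integral => w /set_mem Ew; rewrite /f.
  rewrite !nth_arrival; [|lia..].
  have -> : j = (m + l.+3).+1 by rewrite jE addnS.
  rewrite fine_interclaim; last by apply: arrival_lty => //; lia.
  rewrite fine_interclaim; last by apply: arrival_lty => //; lia.
  by rewrite /= [(m + l.+3)%N]addnS.
rewrite (aint (f := f)); [|by seq_meas|by nonneg]; congr (_ * _).
have [k nE] : exists k, n = (m.+1 + (l.+1 + k.+1).+1)%N by exists (n - j)%N; lia.
have -> : (n - j)%N = k by lia.
have -> : (j - m.+2 - 2)%N = l by lia.
have -> : (m.+2 - 2)%N = m by lia.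
by rewrite nE; exact: simplex_marginal_two_pairs.
Qed.

End Terms.

(** * The square of a sum of claims *)

Section ErealSums.
Context (R : realType).

(** No condition on x + y: a positive real factor commutes with the convention
    +oo - oo = -oo. *)
Lemma gt0_EFin_muleDr (c : R) (x y : \bar R) : (0 < c)%R ->
  c%:E * (x + y) = c%:E * x + c%:E * y.
Proof.
move=> c0.
have hy : c%:E * +oo = +oo by rewrite gt0_muley ?lte_fin.
have hNy : c%:E * -oo = -oo by rewrite gt0_muleNy ?lte_fin.
case: x => [x| |]; case: y => [y| |]; rewrite ?hy ?hNy ?addeNy ?addNye ?hNy//.
by rewrite -EFinD -!EFinM -EFinD mulrDr.
Qed.

Lemma gt0_EFin_mule_sumr (I : Type) (s : seq I) (Q : pred I) (F : I -> \bar R) (c : R) :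
  (0 < c)%R ->
  c%:E * (\sum_(i <- s | Q i) F i) = \sum_(i <- s | Q i) (c%:E * F i).
Proof.
move=> c0; apply: (big_morph (fun x => c%:E * x)); last by rewrite mule0.
by move=> x y; exact: gt0_EFin_muleDr.
Qed.

(** The pairs i < j are sorted by whether i = 1 and whether j = i + 1, the cases
    in which some of the times T (i - 1), V i, T (j - 1), V j are redundant. *)
Lemma sum_pairs_by_gap (W : nat -> nat -> \bar R) n : (2 <= n)%N ->
  W 1%N 2%N + \sum_(3 <= j < n.+1) W 1%N j + \sum_(2 <= i < n) W i i.+1
    + \sum_(2 <= i < n.-1) \sum_(i.+2 <= j < n.+1) W i j
  = \sum_(1 <= i < n) \sum_(i.+1 <= j < n.+1) W i j.
Proof.
move=> n2; rewrite [RHS]big_ltn//.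
have -> : \sum_(2 <= j < n.+1) W 1%N j = W 1%N 2%N + \sum_(3 <= j < n.+1) W 1%N j.
  by rewrite big_ltn// ltnS.
rewrite -addeA; congr (_ + _).
have -> : \sum_(2 <= i < n) \sum_(i.+1 <= j < n.+1) W i j =
    \sum_(2 <= i < n) (W i i.+1 + \sum_(i.+2 <= j < n.+1) W i j).
  by apply: eq_big_nat => i /andP[i2 ni]; rewrite big_ltn.
rewrite big_split/=; congr (_ + _).
case: n n2 => [|[|n]]// _.
case: n => [|n]; first by rewrite !big_geq.
by rewrite [RHS]big_nat_recr//= [X in _ = _ + X]big_geq// adde0.
Qed.

Lemma sqr_sum (x : nat -> R) n :
  ((\sum_(1 <= i < n.+1) x i) ^+ 2 = \sum_(1 <= i < n.+1) x i ^+ 2 +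
    (\sum_(1 <= i < n) \sum_(i.+1 <= j < n.+1) x i * x j) *+ 2)%R.
Proof.
elim: n => [|n IHn]; first by rewrite !big_geq// expr0n mul0rn addr0.
case: n IHn => [|n] IHn.
  by rewrite !big_nat1 big_geq// mul0rn addr0.
rewrite big_nat_recr//= sqrrD IHn [in RHS]big_nat_recr//=.
have -> : (\sum_(1 <= i < n.+2) \sum_(i.+1 <= j < n.+3) x i * x j =
   \sum_(1 <= i < n.+1) \sum_(i.+1 <= j < n.+2) x i * x j +
   (\sum_(1 <= i < n.+2) x i) * x n.+2)%R.
  rewrite mulr_suml.
  rewrite (eq_big_nat _ _ (F2 := fun i => (\sum_(i.+1 <= j < n.+2) x i * x j +
     x i * x n.+2)%R)); last first.
    by move=> i /andP[i1 ni]; rewrite big_nat_recr.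
  rewrite big_split/= [X in (X + _)%R]big_nat_recr//= [X in (_ + X + _)%R]big_geq//.
  by rewrite addr0.
set a := (\sum_(1 <= i < n.+2) x i ^+ 2)%R; set b := (\sum_(1 <= i < n.+2) x i)%R.
set c := (\sum_(1 <= i < n.+1) \sum_(i.+1 <= j < n.+2) x i * x j)%R.
by move: a b c (x n.+2) => a b c y; ring.
Qed.

End ErealSums.

Section IntegralSums.
Context d (T : measurableType d) (R : realType).
Variables (m : {measure set T -> \bar R}) (E : set T).
Hypothesis mE : measurable E.

Definition neg_integrable (f : T -> R) :=
  measurable_fun setT f /\ \int[m]_(w in E) (EFin \o f)^\- w < +oo.

(** The sum of the negative parts dominates the negative part of the sum, and
    both integrals avoid -oo. *)
Lemma neg_integrableD (f g : T -> R) : neg_integrable f -> neg_integrable g ->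
  neg_integrable (fun w => f w + g w)%R /\
  \int[m]_(w in E) (f w + g w)%:E =
  \int[m]_(w in E) (f w)%:E + \int[m]_(w in E) (g w)%:E.
Proof.
move=> [mf foo] [mg goo].
have mfE : measurable_fun setT (EFin \o f) by exact/measurable_EFinP.
have mgE : measurable_fun setT (EFin \o g) by exact/measurable_EFinP.
have mfp := measurable_funepos mfE; have mfn := measurable_funeneg mfE.
have mgp := measurable_funepos mgE; have mgn := measurable_funeneg mgE.
have nD : \int[m]_(w in E) ((EFin \o f)^\- w + (EFin \o g)^\- w) =
    \int[m]_(w in E) (EFin \o f)^\- w + \int[m]_(w in E) (EFin \o g)^\- w.
  by rewrite ge0_integralD//; exact: measurable_funTS.
have pD : \int[m]_(w in E) ((EFin \o f)^\+ w + (EFin \o g)^\+ w) =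
    \int[m]_(w in E) (EFin \o f)^\+ w + \int[m]_(w in E) (EFin \o g)^\+ w.
  by rewrite ge0_integralD//; exact: measurable_funTS.
have noo : \int[m]_(w in E) ((EFin \o f)^\- w + (EFin \o g)^\- w) < +oo.
  by rewrite nD lte_add_pinfty.
have mD : measurable_fun setT (fun w => f w + g w)%R by exact: measurable_funD.
have mDE : measurable_fun setT (fun w => (f w + g w)%:E) by exact/measurable_EFinP.
have S : splits m E (fun w => (f w + g w)%:E)
    (fun w => (EFin \o f)^\+ w + (EFin \o g)^\+ w)
    (fun w => (EFin \o f)^\- w + (EFin \o g)^\- w).
  split => //.
  - exact: emeasurable_funD.
  - exact: emeasurable_funD.
  - by move=> w _; rewrite adde_ge0.
  - by move=> w _; rewrite adde_ge0.
  - apply: aeW => w _; rewrite !funeposE !funenegE /= -!EFin_max -!EFinD.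
    congr EFin.
    have h (x : R) : (x = Num.max x 0 - Num.max (- x) 0)%R.
      have [x0|x0] := leP x 0%R.
        by rewrite max_l ?oppr_ge0// sub0r opprK.
      by rewrite max_r ?oppr_le0 ?ltW// subr0.
    by rewrite {1}(h (f w)) {1}(h (g w)) opprD addrACA.
split.
  split=> //; apply: le_lt_trans noo; apply: ge0_le_integral => //.
  - by apply: measurable_funTS; exact: measurable_funeneg.
  - by apply: measurable_funTS; exact: emeasurable_funD.
  - move=> w _; rewrite !funenegE /= -!EFin_max -!EFinD lee_fin opprD.
    rewrite ge_max; apply/andP; split.
      by apply: lerD; rewrite le_max lexx.
    by rewrite addr_ge0// le_max lexx orbT.
rewrite (splits_integral mE S) pD nD.
have -> : \int[m]_(w in E) (f w)%:E =
  \int[m]_(w in E) (EFin \o f)^\+ w - \int[m]_(w in E) (EFin \o f)^\- w.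
  exact: integralE.
have -> : \int[m]_(w in E) (g w)%:E =
  \int[m]_(w in E) (EFin \o g)^\+ w - \int[m]_(w in E) (EFin \o g)^\- w.
  exact: integralE.
rewrite fin_num_oppeD; first exact: addeACA.
by rewrite ge0_fin_numE// integral_ge0.
Qed.

Lemma neg_integrable_sum (I : eqType) (s : seq I) (F : I -> T -> R) :
  (forall i, i \in s -> neg_integrable (F i)) ->
  neg_integrable (fun w => \sum_(i <- s) F i w)%R /\
  \int[m]_(w in E) (\sum_(i <- s) F i w)%:E =
  \sum_(i <- s) \int[m]_(w in E) (F i w)%:E.
Proof.
elim: s => [_|i s IHs FP].
  rewrite big_nil; under eq_integral do rewrite big_nil; rewrite integral0.
  split=> //; split; first by under eq_fun do rewrite big_nil; exact: measurable_cst.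
  rewrite integral0_eq// => w _.
  by rewrite funenegE /= big_nil oppr0 maxxx.
have [|IHn IHE] := IHs; first by move=> j js; apply: FP; rewrite inE js orbT.
have [nD ED] := neg_integrableD (FP i (mem_head _ _)) IHn.
split; first by under eq_fun do rewrite big_cons.
by rewrite big_cons -IHE -ED; apply: eq_integral => w _; rewrite big_cons.
Qed.

End IntegralSums.

Lemma integral_sqr_sum d (T : measurableType d) (R : realType)
    (m : {measure set T -> \bar R}) (E : set T) (x : nat -> T -> R) n :
  measurable E ->
  (forall i, measurable_fun setT (x i)) ->
  (forall i j, (1 <= i < j)%N -> (j <= n)%N ->
     \int[m]_(w in E) (EFin \o (fun w => x i w * x j w)%R)^\- w < +oo) ->
  \int[m]_(w in E) ((\sum_(1 <= i < n.+1) x i w) ^+ 2)%:E =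
  \sum_(1 <= i < n.+1) \int[m]_(w in E) (x i w ^+ 2)%:E +
  2%:E * \sum_(1 <= i < n) \sum_(i.+1 <= j < n.+1)
    \int[m]_(w in E) (x i w * x j w)%:E.
Proof.
move=> mE mx xneg.
have sqrP i : neg_integrable m E (fun w => x i w ^+ 2)%R.
  split; first exact: measurable_funX.
  rewrite integral0_eq// => w _; rewrite funenegE /= max_r// lee_fin.
  by rewrite oppr_le0 sqr_ge0.
have prodP i j : (1 <= i < j)%N -> (j <= n)%N ->
    neg_integrable m E (fun w => x i w * x j w)%R.
  by move=> ij jn; split; [exact: measurable_funM|exact: xneg].
have rowP i : (1 <= i)%N ->
    neg_integrable m E (fun w => \sum_(i.+1 <= j < n.+1) x i w * x j w)%R /\
    \int[m]_(w in E) (\sum_(i.+1 <= j < n.+1) x i w * x j w)%:E =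
    \sum_(i.+1 <= j < n.+1) \int[m]_(w in E) (x i w * x j w)%:E.
  move=> i1; apply: (neg_integrable_sum mE (F := fun j w => x i w * x j w)%R).
  by move=> j; rewrite mem_index_iota ltnS => /andP[ij jn]; apply: prodP; rewrite ?i1.
have [crossP crossE] : neg_integrable m E
      (fun w => \sum_(1 <= i < n) \sum_(i.+1 <= j < n.+1) x i w * x j w)%R /\
    \int[m]_(w in E)
      (\sum_(1 <= i < n) \sum_(i.+1 <= j < n.+1) x i w * x j w)%:E =
    \sum_(1 <= i < n) \int[m]_(w in E)
      (\sum_(i.+1 <= j < n.+1) x i w * x j w)%:E.
  apply: (neg_integrable_sum mE
    (F := fun i w => \sum_(i.+1 <= j < n.+1) x i w * x j w)%R).
  by move=> i; rewrite mem_index_iota => /andP[i1 _]; have [] := rowP i i1.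
have [diagP diagE] := neg_integrable_sum mE (s := index_iota 1 n.+1)
  (F := fun i w => x i w ^+ 2)%R (fun i _ => sqrP i).
have [twiceP twiceE] := neg_integrableD mE crossP crossP.
have [_ totE] := neg_integrableD mE diagP twiceP.
under eq_integral do rewrite sqr_sum mulr2n.
rewrite totE diagE twiceE crossE mule_natl; congr (_ + _).
have -> : \sum_(1 <= i < n) \sum_(i.+1 <= j < n.+1)
      \int[m]_(w in E) (x i w * x j w)%:E =
    \sum_(1 <= i < n) \int[m]_(w in E)
      (\sum_(i.+1 <= j < n.+1) x i w * x j w)%:E.
  by apply: eq_big_nat => i /andP[i1 _]; have [_ ->] := rowP i i1.
by [].
Qed.

Lemma cross_coef1 (R : realType) (q12 : R * R -> \bar R)
    (q1 qs : nat -> R * R * R -> \bar R)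
    (q : nat -> nat -> R * R * R * R -> \bar R) (t : R) :
  cross_coef q12 q1 qs q t 1 = 0.
Proof.
rewrite /cross_coef muln0 mul0e add0e.
rewrite [X in _ + X]big_geq; last by [].
rewrite [X in _ + X + _]big_geq; last by [].
by rewrite [X in X + _ + _]big_geq; [rewrite !adde0|].
Qed.

(** * The second moment on the event of n claims *)

Section CountMoment.
Context (d : measure_display) (Omega : measurableType d) (R : realType).
Variables (P : probability Omega R) (Lambda : {RV P >-> R})
  (T : nat -> Omega -> \bar R) (N : R -> Omega -> nat) (X : nat -> {RV P >-> R})
  (t : R)
  (r1 : R -> \bar R) (r : nat -> R * R -> \bar R)
  (q12 : R * R -> \bar R) (q1 : nat -> R * R * R -> \bar R)
  (qs : nat -> R * R * R -> \bar R)
  (q : nat -> nat -> R * R * R * R -> \bar R).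
Hypotheses (t0 : (0 < t)%R) (Lambda_ge0 : forall w, (0 <= Lambda w)%R)
  (HT : claim_arrivals T N) (HN : mixed_poisson Lambda N).
Hypotheses
  (dep1 : forall i, (1 <= i)%N ->
     depends_only_via P N (fun w => X i w) [set w | T i w < +oo]
       (fun w => (fine (T i.-1 w), fine (interclaim T i w))))
  (dep2 : forall i j, (1 <= i < j)%N ->
     depends_only_via P N (fun w => X i w * X j w)%R [set w | T j w < +oo]
       (fun w => (fine (T i.-1 w), fine (interclaim T i w),
                  fine (T j.-1 w), fine (interclaim T j w))))
  (Hneg : forall n i j, (1 <= i < j)%N -> (j <= n)%N ->
     \int[P]_(w in [set w | N t w = n])
       (EFin \o (fun w => X i w * X j w)%R)^\- w < +oo)
  (reg1 : regression P (fun w => X 1%N w ^+ 2)%R [set w | T 1%N w < +oo]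
    (fun w => fine (T 1%N w)) r1)
  (reg : forall i, (2 <= i)%N ->
     regression P (fun w => X i w ^+ 2)%R [set w | T i w < +oo]
       (fun w => (fine (T i.-1 w), fine (interclaim T i w))) (r i))
  (reg12 : regression P (fun w => X 1%N w * X 2%N w)%R [set w | T 2%N w < +oo]
    (fun w => (fine (T 1%N w), fine (interclaim T 2%N w))) q12)
  (reg1j : forall j, (3 <= j)%N ->
     regression P (fun w => X 1%N w * X j w)%R [set w | T j w < +oo]
       (fun w => (fine (T 1%N w), fine (T j.-1 w), fine (interclaim T j w)))
       (q1 j))
  (regs : forall i, (2 <= i)%N ->
     regression P (fun w => X i w * X i.+1 w)%R [set w | T i.+1 w < +oo]
       (fun w => (fine (T i.-1 w), fine (interclaim T i w),
                  fine (interclaim T i.+1 w))) (qs i))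
  (regij : forall i j, (2 <= i)%N -> (i.+2 <= j)%N ->
     regression P (fun w => X i w * X j w)%R [set w | T j w < +oo]
       (fun w => (fine (T i.-1 w), fine (interclaim T i w),
                  fine (T j.-1 w), fine (interclaim T j w))) (q i j)).
Variable n : nat.
Local Notation leb := (@lebesgue_measure R).

Let E := [set w | N t w = n].

Let mE : measurable E.
Proof. by apply: (measurable_count HT); exact: ltW. Qed.

Let mfT i := @fine_arrival_sigma_process _ _ _ _ _ HT i.
Let mfV i := @interclaim_sigma_process _ _ _ _ _ HT i.
Let sfin i := @sigma_process_finite _ _ _ _ _ HT i.

Let EsubD i : (i <= n)%N -> E `<=` [set w | T i w < +oo].
Proof. by move=> ni w Ew; exact: (arrival_lty HT t0 Ew). Qed.

Let mX i : measurable_fun setT (fun w => X i w).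
Proof. exact: measurable_funPT. Qed.

Let mXX i j : measurable_fun setT (fun w => X i w * X j w)%R.
Proof. exact: measurable_funM. Qed.

Let msqr : measurable_fun setT (fun y : R => y ^+ 2)%R.
Proof. exact: measurable_funX. Qed.

Let mid : measurable_fun setT (fun y : R => y).
Proof. exact: measurable_id. Qed.

Let negsqr (f : Omega -> R) : \int[P]_(w in E) (EFin \o (fun w => f w ^+ 2)%R)^\- w < +oo.
Proof.
rewrite integral0_eq// => w _; rewrite funenegE /= max_r// lee_fin.
by rewrite oppr_le0 sqr_ge0.
Qed.

(** For the first claim T 0 = 0, so that V 1 = T 1 is the only time left. *)
Lemma square_term_first : (0 < n)%N ->
  \int[P]_(w in E) (X 1%N w ^+ 2)%:E = P E * (n%:R%:E *
    \int[leb]_(y in `[0%R, t]) (r1 y * ((t - y) ^+ n.-1 / t ^+ n)%:E)).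
Proof.
move=> n0.
have mphi : measurable_fun setT (fun y : R => (0%R : R, y)).
  by apply: measurable_fun_pair; [exact: measurable_cst|exact: measurable_id].
have ZE w : T 1%N w < +oo ->
    (fine (T 0%N w), fine (interclaim T 1 w)) = (0%R : R, fine (T 1%N w)).
  by move=> T1; rewrite (fine_interclaim HT)// (arrival0 HT) /= subr0.
have c0 : (0 < n%:R :> R)%R by rewrite ltr0n.
exact: (regression_term HT t0 (mX 1) msqr (sfin 1) (EsubD n0)
  (mfT 1) mphi ZE (dep1 (leqnn 1)) reg1
  (fun p mp p0 => marginal_first HT HN Lambda_ge0 t0 n0 mp p0)
  (@splitting_first R t t0 n.-1 n) c0 (negsqr (X 1%N))).
Qed.

Lemma coef_gt0 a b : (0 < a`!%:R / b%:R :> R)%R = (0 < b)%N.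
Proof.
case: b => [|b]; first by rewrite invr0 mulr0 ltxx.
by rewrite divr_gt0// ltr0n fact_gt0.
Qed.

Lemma square_term i : (2 <= i <= n)%N ->
  \int[P]_(w in E) (X i w ^+ 2)%:E =
  P E * ((n`!%:R / ((i - 2)`! * (n - i)`!)%N%:R)%:E *
      \int[leb]_(x in `[0%R, t]) \int[leb]_(v in `[0%R, (t - x)%R])
        (r i (x, v) * (x ^+ (i - 2) * (t - x - v) ^+ (n - i) / t ^+ n)%:E)).
Proof.
move=> i2n; have /andP[i2 ni] := i2n.
have c0 : (0 < n`!%:R / ((i - 2)`! * (n - i)`!)%N%:R :> R)%R.
  by rewrite coef_gt0 muln_gt0 !fact_gt0.
exact: (regression_term HT t0 (mX i) msqr (sfin i) (EsubD ni)
  (measurable_fun_pair (mfT i.-1) (mfV i)) (@measurable_id _ _ setT)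
  (fun w _ => erefl) (dep1 (ltnW i2)) (reg i2)
  (fun p mp p0 => marginal_pair HT HN Lambda_ge0 t0 i2n mp p0)
  (@splitting_pair R t t0 (i - 2) (n - i) n) c0 (negsqr (X i))).
Qed.

(** T 0 = 0 and V 1 = T 1 = T (2 - 1): the times of the pair reduce to T 1
    and V 2. The marginal is that of T (i - 1) and V i at i = 2. *)
Lemma cross_term_12 : (2 <= n)%N ->
  \int[P]_(w in E) (X 1%N w * X 2%N w)%:E =
  P E * ((n * n.-1)%N%:R%:E *
    \int[leb]_(y in `[0%R, t]) \int[leb]_(v in `[0%R, (t - y)%R])
      (q12 (y, v) * ((t - y - v) ^+ (n - 2) / t ^+ n)%:E)).
Proof.
move=> n2; have i2n : (2 <= 2 <= n)%N by [].
have h12 : (1 <= 1 < 2)%N by [].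
have mphi : measurable_fun setT (fun z : R * R => (0%R : R, z.1, z.1, z.2)).
  by do ?[apply: measurable_fun_pair]; [exact: measurable_cst|exact: measurable_fst
    |exact: measurable_fst|exact: measurable_snd].
have ZE w : T 2%N w < +oo ->
    (fine (T 0%N w), fine (interclaim T 1 w), fine (T 1%N w), fine (interclaim T 2 w))
    = (0%R : R, fine (T 1%N w), fine (T 1%N w), fine (interclaim T 2 w)).
  move=> T2; have T1 : T 1%N w < +oo.
    by apply: le_lt_trans T2; exact: (arrival_leS HT).
  by rewrite (fine_interclaim HT T1) (arrival0 HT) /= subr0.
have c0 : (0 < n`!%:R / ((2 - 2)`! * (n - 2)`!)%N%:R :> R)%R.
  by rewrite coef_gt0 muln_gt0 !fact_gt0.
transitivity (P E * ((n`!%:R / ((2 - 2)`! * (n - 2)`!)%N%:R)%:E *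
      \int[leb]_(x in `[0%R, t]) \int[leb]_(v in `[0%R, (t - x)%R])
        (q12 (x, v) * (x ^+ (2 - 2) * (t - x - v) ^+ (n - 2) / t ^+ n)%:E))).
  exact: (regression_term HT t0 (mXX 1 2) mid (sfin 2) (EsubD n2)
    (measurable_fun_pair (mfT 1) (mfV 2)) mphi ZE (dep2 h12) reg12
    (fun p mp p0 => marginal_pair HT HN Lambda_ge0 t0 i2n mp p0)
    (@splitting_pair R t t0 (2 - 2) (n - 2) n) c0 (Hneg h12 n2)).
congr (_ * (_%:E * _)).
  have -> : n`! = (n * n.-1 * (n - 2)`!)%N.
    by case: (n) n2 => [|[|k]]// _; rewrite !factS subn2 /= mulnA.
  by rewrite subnn fact0 mul1n natrM mulfK// pnatr_eq0 -lt0n fact_gt0.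
apply: eq_integral => y _; apply: eq_integral => v _.
by rewrite subnn expr0 mul1r.
Qed.

(** T 0 = 0 and V 1 = T 1, but T 1 and T (j - 1) are now distinct. *)
Lemma cross_term_1j j : (3 <= j <= n)%N ->
  \int[P]_(w in E) (X 1%N w * X j w)%:E =
  P E * ((n`!%:R / ((j - 3)`! * (n - j)`!)%N%:R)%:E *
      \int[leb]_(y in `[0%R, t]) \int[leb]_(w in `[y, t])
      \int[leb]_(v in `[0%R, (t - w)%R])
        (q1 j (y, w, v) *
         ((w - y) ^+ (j - 3) * (t - w - v) ^+ (n - j) / t ^+ n)%:E)).
Proof.
move=> j3n; have /andP[j3 jn] := j3n.
have j2 : (1 <= 1 < j)%N by exact: (leq_trans _ j3).
have mphi : measurable_fun setT
    (fun z : R * R * R => (0%R : R, z.1.1, z.1.2, z.2)).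
  by do ?[apply: measurable_fun_pair]; [exact: measurable_cst
    |exact: (measurableT_comp measurable_fst measurable_fst)
    |exact: (measurableT_comp measurable_snd measurable_fst)|exact: measurable_snd].
have ZE w : T j w < +oo ->
    (fine (T 0%N w), fine (interclaim T 1 w), fine (T j.-1 w), fine (interclaim T j w))
    = (0%R : R, fine (T 1%N w), fine (T j.-1 w), fine (interclaim T j w)).
  move=> Tj; have T1 : T 1%N w < +oo.
    by apply: le_lt_trans Tj; apply: (arrival_homo HT); exact: ltnW (ltnW _).
  by rewrite (fine_interclaim HT T1) (arrival0 HT) /= subr0.
have c0 : (0 < n`!%:R / ((j - 3)`! * (n - j)`!)%N%:R :> R)%R.
  by rewrite coef_gt0 muln_gt0 !fact_gt0.
exact: (regression_term HT t0 (mXX 1 j) mid (sfin j) (EsubD jn)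
  (measurable_fun_pair (measurable_fun_pair (mfT 1) (mfT j.-1)) (mfV j)) mphi ZE
  (dep2 j2) (reg1j j3)
  (fun p mp p0 => marginal_first_pair HT HN Lambda_ge0 t0 j3n mp p0)
  (@splitting_first_pair R t t0 (j - 3) (n - j) n) c0 (Hneg j2 jn)).
Qed.

(** T i = T (i - 1) + V i is determined by the times of the first claim of the
    pair. *)
Lemma cross_term_consecutive i : (2 <= i < n)%N ->
  \int[P]_(w in E) (X i w * X i.+1 w)%:E =
  P E * ((n`!%:R / ((i - 2)`! * (n - i - 1)`!)%N%:R)%:E *
      \int[leb]_(y in `[0%R, t]) \int[leb]_(u in `[0%R, (t - y)%R])
      \int[leb]_(v in `[0%R, (t - y - u)%R])
        (qs i (y, u, v) *
         (y ^+ (i - 2) * (t - y - u - v) ^+ (n - i - 1) / t ^+ n)%:E)).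
Proof.
move=> i2n; have /andP[i2 ni] := i2n.
have ii : (1 <= i < i.+1)%N by rewrite leqnn andbT ltnW.
have mphi : measurable_fun setT
    (fun z : R * R * R => (z.1.1, z.1.2, z.1.1 + z.1.2, z.2)%R).
  have m1 := measurableT_comp (@measurable_fst _ _ R R) (@measurable_fst _ _ (R * R)%type R).
  have m2 := measurableT_comp (@measurable_snd _ _ R R) (@measurable_fst _ _ (R * R)%type R).
  by do ?[apply: measurable_fun_pair] => //; exact: measurable_funD m1 m2.
have ZE w : T i.+1 w < +oo ->
    (fine (T i.-1 w), fine (interclaim T i w), fine (T i w), fine (interclaim T i.+1 w))
    = (fine (T i.-1 w), fine (interclaim T i w),
       fine (T i.-1 w) + fine (interclaim T i w), fine (interclaim T i.+1 w))%R.
  move=> TS; have : T i w < +oo.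
    by apply: le_lt_trans TS; exact: (arrival_leS HT).
  case: (i) i2 => // k _ Tk /=.
  rewrite [in (fine (T k w) + _)%R](fine_interclaim HT Tk).
  by rewrite (addrC (fine (T k w))) subrK.
have c0 : (0 < n`!%:R / ((i - 2)`! * (n - i - 1)`!)%N%:R :> R)%R.
  by rewrite coef_gt0 muln_gt0 !fact_gt0.
exact: (regression_term HT t0 (mXX i i.+1) mid (sfin i.+1) (EsubD ni)
  (measurable_fun_pair (measurable_fun_pair (mfT i.-1) (mfV i)) (mfV i.+1)) mphi ZE
  (dep2 ii) (regs i2)
  (fun p mp p0 => marginal_consecutive HT HN Lambda_ge0 t0 i2n mp p0)
  (@splitting_consecutive R t t0 (i - 2) (n - i - 1) n) c0 (Hneg ii ni)).
Qed.

Lemma cross_term_two_pairs i j : (2 <= i)%N -> (i.+2 <= j <= n)%N ->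
  \int[P]_(w in E) (X i w * X j w)%:E =
  P E * ((n`!%:R / ((i - 2)`! * (j - i - 2)`! * (n - j)`!)%N%:R)%:E *
      \int[leb]_(x in `[0%R, t]) \int[leb]_(u in `[0%R, (t - x)%R])
      \int[leb]_(w in `[(x + u)%R, t]) \int[leb]_(v in `[0%R, (t - w)%R])
        (q i j (x, u, w, v) *
         (x ^+ (i - 2) * (w - x - u) ^+ (j - i - 2) * (t - w - v) ^+ (n - j)
          / t ^+ n)%:E)).
Proof.
move=> i2 ijn; have /andP[ij jn] := ijn.
have ij1 : (1 <= i < j)%N by rewrite ltnW// ltnW.
have c0 : (0 < n`!%:R / ((i - 2)`! * (j - i - 2)`! * (n - j)`!)%N%:R :> R)%R.
  by rewrite coef_gt0 !muln_gt0 !fact_gt0.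
exact: (regression_term HT t0 (mXX i j) mid (sfin j) (EsubD jn)
  (measurable_fun_pair (measurable_fun_pair (measurable_fun_pair (mfT i.-1) (mfV i))
    (mfT j.-1)) (mfV j)) (@measurable_id _ _ setT)
  (fun w _ => erefl) (dep2 ij1) (regij i2 ij)
  (fun p mp p0 => marginal_two_pairs HT HN Lambda_ge0 t0 i2 ijn mp p0)
  (@splitting_two_pairs R t t0 (i - 2) (j - i - 2) (n - j) n) c0 (Hneg ij1 jn)).
Qed.

Let square_sum (e : R) : (0 < e)%R -> P E = e%:E -> (0 < n)%N ->
  \sum_(1 <= i < n.+1) \int[P]_(w in E) (X i w ^+ 2)%:E =
  e%:E * square_coef r1 r t n.
Proof.
move=> e0 PE n0; rewrite /square_coef (gt0_EFin_muleDr _ _ e0).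
rewrite (gt0_EFin_mule_sumr _ _ _ e0).
rewrite (big_ltn (m := 1)); last by rewrite ltnS.
rewrite (square_term_first n0) PE; congr (_ + _).
by apply: eq_big_nat => i i2n; rewrite (square_term i2n) PE.
Qed.

Let cross_sum (e : R) : (0 < e)%R -> P E = e%:E -> (2 <= n)%N ->
  \sum_(1 <= i < n) \sum_(i.+1 <= j < n.+1)
    \int[P]_(w in E) (X i w * X j w)%:E =
  e%:E * cross_coef q12 q1 qs q t n.
Proof.
move=> e0 PE n2.
rewrite -(sum_pairs_by_gap (fun i j => \int[P]_(w in E) (X i w * X j w)%:E) n2).
rewrite /cross_coef.
rewrite [RHS](gt0_EFin_muleDr _ _ e0); congr (_ + _); last first.
  rewrite [RHS](gt0_EFin_mule_sumr _ _ _ e0).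
  apply: eq_big_nat => i /andP[i2 _]; rewrite [RHS](gt0_EFin_mule_sumr _ _ _ e0).
  by apply: eq_big_nat => j ijn; rewrite (cross_term_two_pairs i2 ijn) PE.
rewrite [RHS](gt0_EFin_muleDr _ _ e0); congr (_ + _); last first.
  rewrite [RHS](gt0_EFin_mule_sumr _ _ _ e0).
  by apply: eq_big_nat => i i2n; rewrite (cross_term_consecutive i2n) PE.
rewrite [RHS](gt0_EFin_muleDr _ _ e0); congr (_ + _); last first.
  rewrite [RHS](gt0_EFin_mule_sumr _ _ _ e0).
  by apply: eq_big_nat => j j3n; rewrite (cross_term_1j j3n) PE.
by rewrite (cross_term_12 n2) PE.
Qed.

Let msum : measurable_fun setT (fun w => \sum_(1 <= i < n.+1) X i w)%R.
Proof. exact: measurable_sum. Qed.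

(** When n claims have probability 0 both sides vanish, whatever the
    coefficients are. Otherwise the probability is a positive real number and
    can be distributed over the sums that define the coefficients. *)
Lemma count_second_moment : (0 < n)%N ->
  \int[P]_(w in E) (aggregate_claims N X t w ^+ 2)%:E =
  P E * (square_coef r1 r t n + 2%:E * cross_coef q12 q1 qs q t n).
Proof.
move=> n0.
transitivity (\int[P]_(w in E) ((\sum_(1 <= i < n.+1) X i w) ^+ 2)%:E).
  by apply: eq_integral => w /set_mem Ew; rewrite /aggregate_claims Ew.
have PEfin : P E \is a fin_num by exact: fin_num_measure.
have : 0 <= P E by exact: measure_ge0.
rewrite le_eqVlt => /orP[/eqP PE0|PEgt0].
  rewrite -PE0 mul0e; apply: null_set_integral => //.
  by apply/measurable_EFinP; apply: measurable_funTS; exact: measurable_funX msum.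
have PE : P E = (fine (P E))%:E by rewrite fineK.
have e0 : (0 < fine (P E))%R by rewrite -lte_fin -PE.
rewrite (integral_sqr_sum mE (x := fun i w => X i w) mX (@Hneg n)).
rewrite PE (gt0_EFin_muleDr _ _ e0) (square_sum e0 PE n0).
congr (_ + _).
move: n0; rewrite leq_eqVlt => /orP[/eqP n1|n2].
  by rewrite -n1 cross_coef1 big_geq; rewrite ?mule0.
by rewrite (cross_sum e0 PE n2) [RHS]muleCA.
Qed.

End CountMoment.

(** * The second moment of the aggregate claims *)

Lemma integral_countable_fibers d (T : measurableType d) (R : realType)
    (m : {measure set T -> \bar R}) (c : T -> nat) (f : T -> \bar R) :
  (forall n, measurable [set w | c w = n]) ->
  (forall n, measurable_fun [set w | c w = n] f) -> (forall w, 0 <= f w) ->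
  \int[m]_w f w = \sum_(0 <= n <oo) \int[m]_(w in [set w | c w = n]) f w.
Proof.
move=> mc mf f0.
have cover : [set: T] = \bigcup_n [set w | c w = n].
  by apply/seteqP; split => // w _; exists (c w).
rewrite cover ge0_integral_bigcup//; first exact/measurable_fun_bigcup.
by move=> i j _ _ [w [/= <- <-]].
Qed.

Theorem theorem4p1 (R : realType) (d : measure_display)
    (Omega : measurableType d) (P : probability Omega R)
    (L : cumulativeBounded (0%R : R) (1%R : R)) (Lambda : {RV P >-> R})
    (T : nat -> Omega -> \bar R) (N : R -> Omega -> nat)
    (X : nat -> {RV P >-> R}) (t : R)
    (r1 : R -> \bar R) (r : nat -> R * R -> \bar R)
    (q12 : R * R -> \bar R) (q1 : nat -> R * R * R -> \bar R)
    (qs : nat -> R * R * R -> \bar R)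
    (q : nat -> nat -> R * R * R * R -> \bar R) :
  (0 < t)%R ->
  (* N is the mixed Poisson process with structure cdf L *)
  (forall w, (0 <= Lambda w)%R) ->
  (forall l : R, cdf Lambda l = (L l)%:E) ->
  claim_arrivals T N ->
  mixed_poisson Lambda N ->
  (* dependence assumptions *)
  (forall i, (1 <= i)%N ->
     depends_only_via P N (fun w => X i w) [set w | T i w < +oo]
       (fun w => (fine (T i.-1 w), fine (interclaim T i w)))) ->
  (forall i j, (1 <= i < j)%N ->
     depends_only_via P N (fun w => X i w * X j w)%R [set w | T j w < +oo]
       (fun w => (fine (T i.-1 w), fine (interclaim T i w),
                  fine (T j.-1 w), fine (interclaim T j w)))) ->
  (* the cross expectations given N(t) = n exist in ]-oo, +oo] *)
  (forall n i j, (1 <= i < j)%N -> (j <= n)%N ->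
     \int[P]_(w in [set w | N t w = n])
       (EFin \o (fun w => X i w * X j w)%R)^\- w < +oo) ->
  (* versions of the regression functions *)
  regression P (fun w => X 1%N w ^+ 2)%R [set w | T 1%N w < +oo]
    (fun w => fine (T 1%N w)) r1 ->
  (forall i, (2 <= i)%N ->
     regression P (fun w => X i w ^+ 2)%R [set w | T i w < +oo]
       (fun w => (fine (T i.-1 w), fine (interclaim T i w))) (r i)) ->
  regression P (fun w => X 1%N w * X 2%N w)%R [set w | T 2%N w < +oo]
    (fun w => (fine (T 1%N w), fine (interclaim T 2%N w))) q12 ->
  (forall j, (3 <= j)%N ->
     regression P (fun w => X 1%N w * X j w)%R [set w | T j w < +oo]
       (fun w => (fine (T 1%N w), fine (T j.-1 w), fine (interclaim T j w)))
       (q1 j)) ->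
  (forall i, (2 <= i)%N ->
     regression P (fun w => X i w * X i.+1 w)%R [set w | T i.+1 w < +oo]
       (fun w => (fine (T i.-1 w), fine (interclaim T i w),
                  fine (interclaim T i.+1 w))) (qs i)) ->
  (forall i j, (2 <= i)%N -> (i.+2 <= j)%N ->
     regression P (fun w => X i w * X j w)%R [set w | T j w < +oo]
       (fun w => (fine (T i.-1 w), fine (interclaim T i w),
                  fine (T j.-1 w), fine (interclaim T j w))) (q i j)) ->
  'E_P [fun w => (aggregate_claims N X t w ^+ 2)%R]
  = \sum_(1 <= n <oo) mixed_poisson_weight L t n *
      (square_coef r1 r t n + 2%:E * cross_coef q12 q1 qs q t n).

Proof.
move=> t0 Lambda0 LambdaL HT HN dep1 dep2 Hneg reg1 reg reg12 reg1j regs regij.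
pose S2 w := (aggregate_claims N X t w ^+ 2)%:E.
have mE n : measurable [set w | N t w = n].
  by apply: (measurable_count HT); exact: ltW.
have mS2 n : measurable_fun [set w | N t w = n] S2.
  apply: (eq_measurable_fun (fun w => ((\sum_(1 <= i < n.+1) X i w) ^+ 2)%:E)).
    by move=> w /set_mem /= Nn; rewrite /S2 /aggregate_claims Nn.
  apply/measurable_EFinP; apply: measurable_funTS; apply: measurable_funX.
  exact: measurable_sum.
have S20 w : 0 <= S2 w by rewrite lee_fin sqr_ge0.
rewrite unlock (integral_countable_fibers P mE mS2 S20).
rewrite nneseries_recl//; last by move=> n _; exact: integral_ge0.
rewrite [X in X + _]integral0_eq ?add0e; last first.
  by move=> w /= Nw; rewrite /S2 /aggregate_claims Nw big_geq// expr0n.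
apply: congr_lim; apply/funext => k; apply: eq_big_nat => n /andP[n0 _].
rewrite (mixed_poisson_weightE Lambda0 LambdaL n t0) -(count_law HT HN n t0).
exact: (count_second_moment t0 Lambda0 HT HN dep1 dep2 Hneg reg1 reg reg12 reg1j
  regs regij n0).
Qed.
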